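(* Let $G=A\ast_C B$ be a (non-trivial) amalgamated free product of topological groups such that $A,B$ are compactly generated TDLC groups and $C$ is compact. Then $G$ is hyperbolic if and only if $A$ and $B$ are hyperbolic.
   Context: All topological groups are Hausdorff. A TDLC group is a totally disconnected locally compact group. A topological group is compactly generated if it is algebraically generated by a compact subset. Edges of graphs have length one. Amalgamated free product: $C$ is a topological group with topological isomorphisms $i_A:C\to A$, $i_B:C\to B$ onto open subgroups, and $A\ast_C B$ identifies $i_A(c)$ with $i_B(c)$. It carries the unique group topology for which the inclusions of $A$ and $B$ are open topological embeddings. It is non-trivial: $i_A(C)\neq A$ and $i_B(C)\neq B$. A Cayley-Abels graph of a compactly generated TDLC group $G$ is a locally finite connected graph on which $G$ acts, transitively on vertices, with compact open vertex stabilizers (it exists and is unique up to quasiisometry). A TDLC group is hyperbolic if it is compactly generated and some (hence any) Cayley-Abels graph of it is Gromov hyperbolic. *)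

(* Defs.v *)
From HB Require Import structures.
From mathcomp Require Import all_boot all_order all_algebra.
From mathcomp Require Import boolp classical_sets functions cardinality reals topology.

Set Implicit Arguments.
Unset Strict Implicit.
Unset Printing Implicit Defensive.

Import Order.TTheory GRing.Theory Num.Theory.

Local Open Scope classical_set_scope.
Local Open Scope ring_scope.

(* Topological groups are Hausdorff by convention, hence the third field. *)
HB.mixin Record isTopologicalGroup G of Topological G & Group G := {
  mulg_continuous : continuous (fun x : G * G => (x.1 * x.2)%g) ;
  invg_continuous : continuous (fun x : G => (x^-1)%g) ;
  topgroup_hausdorff : hausdorff_space G
}.

#[short(type="topGroupType")]
HB.structure Definition TopologicalGroup :=
  {G of Topological G & Group G & isTopologicalGroup G}.

Definition is_subgroup (G : groupType) (H : set G) : Prop :=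
  H 1%g /\ forall x y, H x -> H y -> H (x * y^-1)%g.

Definition compactly_generated (G : topGroupType) : Prop :=
  exists K : set G, compact K /\ smallest (@is_subgroup G) K = [set: G].

Definition tdlc (G : topGroupType) : Prop :=
  totally_disconnected [set: G] /\ locally_compact [set: G].

Definition open_embedding (S T : topologicalType) (f : S -> T) : Prop :=
  [/\ injective f, continuous f & forall U : set S, open U -> open (f @` U)].

(* [G], with [jA] and [jB], is the amalgamated free product of [A] and [B]
   over [C]: the pushout of [iA] and [iB] as an abstract group, carrying the
   group topology which makes [jA] and [jB] open embeddings. *)
Record amalgamated_product (A B C G : topGroupType)
    (iA : {multiplicative C -> A}) (iB : {multiplicative C -> B})
    (jA : {multiplicative A -> G}) (jB : {multiplicative B -> G}) : Prop := {
  amalgam_embedA : open_embedding iA ;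
  amalgam_embedB : open_embedding iB ;
  amalgam_glue : forall c, jA (iA c) = jB (iB c) ;
  amalgam_universal : forall (H : groupType)
      (f : {multiplicative A -> H}) (g : {multiplicative B -> H}),
    (forall c, f (iA c) = g (iB c)) ->
    exists h : {multiplicative G -> H},
      [/\ forall a, h (jA a) = f a, forall b, h (jB b) = g b &
          forall h' : {multiplicative G -> H},
            (forall a, h' (jA a) = f a) -> (forall b, h' (jB b) = g b) ->
            h' =1 h] ;
  amalgam_topA : open_embedding jA ;
  amalgam_topB : open_embedding jB
}.

Definition nontrivial_amalgam (A B C : topGroupType)
    (iA : {multiplicative C -> A}) (iB : {multiplicative C -> B}) : Prop :=
  range iA <> [set: A] /\ range iB <> [set: B].

Definition gromov_product (R : realType) (X : Type) (d : X -> X -> R)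
    (w x y : X) : R :=
  (d x w + d y w - d x y) / 2.

Definition gromov_hyperbolic (R : realType) (X : Type) (S : set X)
    (d : X -> X -> R) : Prop :=
  exists delta : R, forall x y z w, S x -> S y -> S z -> S w ->
    Num.min (gromov_product d w x y) (gromov_product d w y z) - delta
      <= gromov_product d w x z.

Section GeometricRealization.
Variables (R : realType) (V : choiceType) (e : rel V).

(* Points of the realization are given by barycentric coordinates on the
   vertices: [edge_point u v t] lies at distance [t] from [u] on the edge
   [uv], and [edge_point u u 0] is the vertex [u]. *)
Definition edge_point (u v : V) (t : R) : V -> R :=
  fun w => (1 - t) *+ (w == u) + t *+ (w == v).

Definition realization : set (V -> R) :=
  [set x | (exists u, x = edge_point u u 0) \/
           (exists u v t, [/\ e u v, 0 <= t <= 1 & x = edge_point u v t])].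

(* Piecewise linear paths, each edge being isometric to the unit interval. *)
Inductive pl_path : (V -> R) -> (V -> R) -> R -> Prop :=
| pl_path_nil x : realization x -> pl_path x x 0
| pl_path_cons u v s t y l : e u v -> 0 <= s <= 1 -> 0 <= t <= 1 ->
    pl_path (edge_point u v t) y l ->
    pl_path (edge_point u v s) y (`|s - t| + l).

Definition realization_dist (x y : V -> R) : R :=
  inf [set l | pl_path x y l].

End GeometricRealization.

Definition hyperbolic_graph (R : realType) (V : choiceType) (e : rel V) : Prop :=
  gromov_hyperbolic (@realization R V e) (@realization_dist R V e).

Definition connected_graph (V : choiceType) (e : rel V) : Prop :=
  forall u v, exists2 p, path e u p & last u p = v.

Record cayley_abels_graph (G : topGroupType) (V : choiceType) (e : rel V)
    (act : G -> V -> V) : Prop := {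
  ca_sym : symmetric e ;
  ca_irr : irreflexive e ;
  ca_connected : connected_graph e ;
  ca_locally_finite : forall v, finite_set [set w | e v w] ;
  ca_act1 : forall v, act 1%g v = v ;
  ca_actM : forall g h v, act (g * h)%g v = act g (act h v) ;
  ca_act_edge : forall g u v, e (act g u) (act g v) = e u v ;
  ca_transitive : exists v0, forall v, exists g, act g v0 = v ;
  ca_stab_compact : forall v, compact [set g | act g v = v] ;
  ca_stab_open : forall v, open [set g | act g v = v]
}.

Definition hyperbolic (R : realType) (G : topGroupType) : Prop :=
  [/\ tdlc G, compactly_generated G &
      exists (V : choiceType) (e : rel V) (act : G -> V -> V),
        cayley_abels_graph e act /\ hyperbolic_graph R e].

(* Main.v *)
Require Import Defs.
From HB Require Import structures.
From mathcomp Require Import all_boot all_order all_algebra.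
From mathcomp Require Import finmap zify ring lra.
From mathcomp Require Import boolp classical_sets functions cardinality reals topology.

(** Fix in a locally compact group [T] an open subgroup [H] and a compact
    symmetric set [S = S H] containing [H] and generating [T]
    ([word_structure]).  The number of elements of [S] needed to write
    [x^-1 * y] up to [H] is a left-invariant integer-valued distance [wdist] on
    [T]; it is the distance of the cosets of [x] and [y] in a Cayley-Abels graph
    with vertex set [T / H] ([coset_graph]), and the distances of all
    Cayley-Abels graphs arise in this way ([ca_word_structure],
    [hyperbolic_graph_wdist]).  By compactness each generating set lies in a
    ball of the other, so any two of these distances are quasi-isometric, and
    the Morse lemma shows that hyperbolicity does not depend on the choice
    ([hyperbolic_quasi_isometry]).  Thus [T] is hyperbolic if and only if
    [wdist H S] satisfies a four-point inequality, for whichever [H] and [S] are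
    convenient ([hyperbolic_wdist]).

    For the amalgam take [H = C] and [S = S_A] union [S_B], where [S_A] and [S_B]
    are generating sets of [A] and [B] invariant under [C] on both sides.  The
    graph on [G / C] is then a tree of blocks: the translates of the graphs on
    [A / C] and [B / C], any two of which share at most one vertex.  Hence
    lengths add up along reduced words ([amalgam_wlen_reduced]).  This is proved
    with the action of [G] on normal forms that van der Waerden used for free
    products; that action comes from the universal property, and the weight of
    a normal form changes by at most one under an element of [S].

    Each block is isometrically embedded, so a four-point inequality for [G]
    restricts to [A] and [B] ([four_point_blocks]).  Conversely, place one of
    four points at the identity and write the other three as reduced words.  A
    common first letter can be removed without affecting the inequality; once
    the three first letters no longer agree modulo [C], either the inequality
    takes place inside one block or it follows from the additivity of length
    ([four_point_of_blocks]). *)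

Set Implicit Arguments.
Unset Strict Implicit.
Unset Printing Implicit Defensive.

Local Open Scope classical_set_scope.

(** * Hyperbolicity of integer-valued metrics *)

Section IntegerMetrics.
Variable X : Type.
Implicit Types d : X -> X -> nat.

(** Points at distance zero need not be equal: on a group, elements of the same
    coset are not distinguished. *)
Record geodesic_pmetric d : Prop := {
  pm_refl : forall x, d x x = 0 ;
  pm_sym : forall x y, d x y = d y x ;
  pm_tri : forall x y z, d x z <= d x y + d y z ;
  pm_mid : forall x y k, k <= d x y ->
    exists z, d x z = k /\ d z y = d x y - k
}.

(** Gromov's inequality for the products based at [w], multiplied by two and
    cleared of subtractions; [delta] is twice the usual constant. *)
Definition four_point d (delta : nat) : Prop := forall x y z w,
  d x z + d y w <= maxn (d x y + d z w) (d y z + d x w) + delta.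

(** Intervals replace geodesic segments: in a hyperbolic space two geodesics
    with the same ends are close, so nothing is lost. *)
Definition between d x y z : Prop := d x z + d z y = d x y.

Definition slim d (delta : nat) : Prop := forall x y t z, between d x y z ->
  exists w, d z w <= delta /\ (between d x t w \/ between d t y w).

(** The four-point inequality for [z, x, t, y] makes [z] nearly lie between [t]
    and one of [x], [y]; the point of that interval at the same distance from
    [t] as [z], or its far end if there is none, is then close to [z]. *)
Lemma four_point_slim d delta : geodesic_pmetric d ->
  four_point d delta -> slim d (delta + delta).
Proof.
move=> [dxx dC dT dM] h4 x y t z; rewrite /between => hz.
wlog hle : x y hz / d z t + d z y <= d t y + delta.
  move=> hw; have h := h4 z x t y.
  have := dC x z; have := dC x t; have := dC z t; have := dC y t; have := dC y x => *.
  have [h1|h1] := leqP (d z t + d z y) (d t y + delta); first exact: hw h1.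
  have [||w [hw1 hw2]] := hw y x.
  - by have := dC y z; have := dC z x; have := dC y x; lia.
  - by have := dC x y; lia.
  exists w; split=> //; have := dC x w; have := dC w t; have := dC w y.
  by case: hw2 => ?; [right|left]; lia.
have [hzt|hzt] := leqP (d z t) (d t y).
  have [w [hw1 hw2]] := dM _ _ _ hzt.
  exists w; split; last by right; lia.
  by have := h4 z t w y; have := dC w y; have := dC t w; have := dC z y; have := dC z t; lia.
exists y; split; last by right; rewrite dxx; lia.
by lia.
Qed.

(** The discrete form of the connectedness of an interval. *)
Lemma nat_switch (P : nat -> Prop) n : P 0 ->
  P n \/ exists k, [/\ k < n, P k & ~ P k.+1].
Proof.
move=> P0; elim: n => [|n [IH|[k [hk h1 h2]]]]; first by left.
- have [Pn|Pn] := pselect (P n.+1); [by left|right].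
  by exists n.
- by right; exists k; split=> //; lia.
Qed.

(** The extra last step has length zero; it makes the path end exactly at [y],
    although [d] does not separate points. *)
Lemma geodesic_path d x y : geodesic_pmetric d -> exists c : nat -> X,
  [/\ c 0 = x, c (d x y).+1 = y,
      forall k, k <= d x y -> d (c k) (c k.+1) <= 1 &
      forall k, k <= (d x y).+1 -> between d x y (c k)].
Proof.
move=> [dxx dC dT dM]; move hn : (d x y) => n.
elim: n x hn => [|n IH] x hn.
  exists (fun k => if k is 0 then x else y); split=> //.
    by case=> // _; rewrite hn.
  by case=> [|k] _; rewrite /between ?dxx ?hn ?dxx.
have [z [hz1 hz2]] : exists z, d x z = 1 /\ d z y = n.
  by have [z [? ?]] := dM x y 1 ltac:(lia); exists z; split; lia.
have [c [c0 cn cs cb]] := IH z hz2.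
exists (fun k => if k is k'.+1 then c k' else x); split=> //.
  by case=> [_|k hk]; [rewrite c0 hz1|exact: cs].
case=> [_|k hk]; first by rewrite /between dxx.
have := cb k hk; have := dT x z (c k); have := dT x (c k) y.
by rewrite /between; lia.
Qed.

Lemma path_length d (c : nat -> X) i j : geodesic_pmetric d ->
  i <= j -> (forall k, i <= k < j -> d (c k) (c k.+1) <= 1) ->
  d (c i) (c j) <= j - i.
Proof.
move=> [dxx dC dT dM] hij; rewrite -(subnK hij) addnC.
elim: (j - i) => [|n IH] hs; first by rewrite addn0 dxx.
have h1 := hs (i + n) ltac:(lia); have h2 := dT (c i) (c (i + n)) (c (i + n.+1)).
have h3 := IH (fun k hk => hs k ltac:(lia)).
by rewrite addnS in h2 *; lia.
Qed.

(** Twice the Gromov product of [x] and [z] at [w] is, up to a constant, twice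
    the distance from [w] to the interval between [x] and [z]: somewhere on that
    interval one passes from the neighbourhood of the side through [x] to that
    of the side through [z].  Slimness of the triangle [x, z, y] then compares
    the distances from [w] to its three sides. *)
Lemma slim_four_point d delta : geodesic_pmetric d ->
  slim d delta -> four_point d (6 * delta + 2).
Proof.
move=> dP sl x y z w.
have [dxx dC dT dM] := dP.
suff [p [hp hpw]] : exists p, between d x z p /\
    2 * d w p + d x z <= d x w + d z w + 4 * delta + 2.
  have [q [hq hqb]] := sl _ _ y _ hp.
  have hwq := dT w p q.
  case: hqb => hqb; move: hqb; rewrite /between => hqb.
    have := dT x q w; have := dT y q w.
    by rewrite (dC q w) (dC y q) (dC y w); lia.
  have := dT y q w; have := dT z q w.
  by rewrite (dC q w) (dC z q) (dC y w); lia.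
have [c [c0 cn cs cb]] := geodesic_path x z dP.
pose Q k := exists p', d (c k) p' <= delta /\ between d x w p'.
have Q0 : Q 0 by exists x; rewrite /between c0 !dxx.
have fin k p' p'' : between d x z (c k) ->
    d (c k) p' <= delta -> between d x w p' ->
    d (c k) p'' <= delta.+1 -> between d w z p'' ->
  2 * d w (c k) + d x z <= d x w + d z w + 4 * delta + 2.
  rewrite /between => h1 h2 h3 h4 h5.
  have := dT x p' (c k); have := dT w p' (c k).
  have := dT w p'' (c k); have := dT (c k) p'' z.
  by rewrite (dC z w) (dC p' (c k)) (dC p'' (c k)) (dC w p'); lia.
have [[p' [h1 h2]]|[k [hk [p' [h1 h2]] nQ]]] := nat_switch (d x z).+1 Q0.
  exists (c (d x z).+1); have hb := cb _ (leqnn _); split=> //.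
  by apply: (fin _ p' z) => //; rewrite ?cn /between dxx ?addn0.
exists (c k); have hb := cb k ltac:(lia); split=> //.
have [p'' [h3 h4]] := sl _ _ w _ (cb k.+1 hk).
case: h4 => h4; first by case: nQ; exists p''.
apply: (fin _ p' p'') => //.
by have := dT (c k) (c k.+1) p''; have := cs k hk; lia.
Qed.

(** Halving the path and using one slim triangle costs [delta] and divides the
    length by two. *)
Lemma log_close d delta L (c : nat -> X) N i j w : geodesic_pmetric d ->
  slim d delta -> j <= 2 ^ N ->
  (forall k, i <= k < i + j -> d (c k) (c k.+1) <= L) ->
  between d (c i) (c (i + j)) w ->
  exists k, i <= k <= i + j /\ d w (c k) <= delta * N + L.
Proof.
move=> [dxx dC dT dM] sl.
elim: N i j w => [|N IH] i j w hj hs hw.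
  case: j hj hs hw => [|[|//]] _ hs; rewrite /between ?addn0 ?addn1 => hw.
    exists i; split; first by lia.
    by move: hw; rewrite dxx (dC w); lia.
  exists i; split; first by lia.
  by have := hs i ltac:(lia); rewrite (dC w); lia.
have [hj'|hj'] := leqP j (2 ^ N).
  have [k [h1 h2]] := IH i j w hj' hs hw.
  by exists k; split=> //; rewrite mulnS; lia.
have [w' [h1 h2]] := sl _ _ (c (i + 2 ^ N)) _ hw.
rewrite expnS in hj.
suff [k [hk1 hk2]] : exists k, i <= k <= i + j /\ d w' (c k) <= delta * N + L.
  by exists k; split=> //; have := dT w w' (c k); rewrite mulnS; lia.
case: h2 => h2.
  have [|k [h3 h4]] := IH i (2 ^ N) w' (leqnn _) _ h2.
    by move=> k hk; apply: hs; lia.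
  by exists k; split=> //; lia.
have [|||k [h3 h4]] := IH (i + 2 ^ N) (j - 2 ^ N) w'.
- by lia.
- by move=> k hk; apply: hs; lia.
- by have -> : i + 2 ^ N + (j - 2 ^ N) = i + j by lia.
by exists k; split=> //; lia.
Qed.

Definition quasi_geodesic d L (c : nat -> X) n : Prop :=
  forall i j, i <= j <= n ->
    d (c i) (c j) <= L * (j - i).+1 /\ j - i <= L * (d (c i) (c j)).+1.

(** This turns the logarithmic estimate [log_close] into an absolute bound. *)
Lemma exp_beats_linear a b L : exists D0, forall m,
  (forall N, a * m + b <= 2 ^ N -> m <= L * N + L) -> m <= D0.
Proof.
have sq N : N.+1 * N.+1 <= 4 * 2 ^ N.
  elim: N => [|[|[|N]] IH] //; rewrite expnS; move: IH; set e := 2 ^ _; nia.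
(* With [N] minimal, [2 ^ N] is less than [2 * (a * m + b)], which is at most
   linear in [N]; but [2 ^ N] is at least a quarter of [N.+1 ^ 2]. *)
pose K := 2 * (a * L + a * L + b + 1).
exists (L * (8 * K) + L) => m hm.
pose N := up_log 2 (a * m + b).
have hN : a * m + b <= 2 ^ N by apply: up_logP.
have hmN := hm _ hN.
suff hNK : N <= 8 * K by nia.
have [hx|hx] := leqP (a * m + b) 1.
  by rewrite /N; case: (a * m + b) hx => [|[|//]] _; rewrite ?up_log0 ?up_log1.
have /andP[h1 _] := up_log_bounds (isT : 1 < 2) hx.
rewrite -/N in h1.
have hN0 : 0 < N by rewrite /N up_log_gt0.
have hN2 : 2 ^ N = 2 * 2 ^ N.-1 by rewrite -expnS prednK.
have h3 : a * m <= a * (L * N + L) by rewrite leq_mul2l hmN orbT.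
have h4 : 2 ^ N <= K * N.+1.
  by rewrite hN2 /K; move: h1 h3; set e := 2 ^ _; nia.
have := sq N; nia.
Qed.

(** First half of the Morse lemma.  Let [w] be a point of the geodesic farthest
    from the quasi-geodesic [c], at distance [m].  Move [2 m] away from [w] on
    both sides and jump to [c]: the stretch of [c] in between has length linear
    in [m], while [log_close] shows that [m] is at most logarithmic in that
    length. *)
Lemma geodesic_near_quasi_geodesic d delta L : geodesic_pmetric d ->
  slim d delta -> exists D0, forall (c : nat -> X) n w,
    quasi_geodesic d L c n -> between d (c 0) (c n) w ->
    exists k, k <= n /\ d w (c k) <= D0.
Proof.
move=> dP sl; have [dxx dC dT dM] := dP.
have [D0 hD0] := exp_beats_linear (6 * L) L (2 * delta + L * 2).
exists D0 => c n w0 qg hw0.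
pose P m := exists w, between d (c 0) (c n) w /\ forall k, k <= n -> m <= d w (c k).
have Pbd m : P m -> m <= d (c 0) (c n).
  by move=> [w [hw h]]; have := h 0 isT; have := dC w (c 0); move: hw; rewrite /between; lia.
have [Pm|[m [hm [w [hw hwm]] nP]]] : P (d (c 0) (c n)).+1 \/ _ :=
  nat_switch _ (ex_intro _ w0 (conj hw0 (fun k _ => isT))).
  by have := Pbd _ Pm; rewrite ltnn.
have near w' : between d (c 0) (c n) w' -> exists k, k <= n /\ d w' (c k) <= m.
  move=> hw'; apply: contrapT => h; apply: nP; exists w'; split=> // k hk.
  by rewrite ltnNge; apply/negP => hle; apply: h; exists k.
suff hmD : m <= D0.
  by have [k [h1 h2]] := near _ hw0; exists k; split=> //; lia.
apply: hD0 => N hN.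
(* Both sides of [w] are treated at once, [e] being 0 or [n].  The segment from
   [y] to [c k] stays at distance at least [m] from [w]: it has length at most
   [m] and starts [2 * m] away, or it is reduced to an end of [c]. *)
have side e : e <= n -> between d (c e) (c (n - e)) w ->
    (forall z, between d (c e) w z -> between d (c 0) (c n) z) ->
  exists y k, [/\ between d (c e) w y, d y w <= 2 * m, k <= n,
     d y (c k) <= m & forall q, between d y (c k) q -> m <= d w q].
  move=> he hwe hsub.
  have [h|h] := leqP (d (c e) w) (2 * m).
    exists (c e), e; split=> //; rewrite ?dxx // /between ?dxx // => q.
    have := hwm e he; have := dT w q (c e); have := dxx (c e); have := dC q (c e); lia.
  have [y [hy1 hy2]] := dM (c e) w (d (c e) w - 2 * m) ltac:(lia).
  have hy : between d (c e) w y by rewrite /between; lia.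
  have [k [hk1 hk2]] := near _ (hsub _ hy).
  exists y, k; split=> //; first lia.
  move=> q; rewrite /between => hq.
  by have := dT y q w; rewrite (dC q w); lia.
move: (hw); rewrite /between => hwE.
have [|||y [i [hy1 hy2 hi1 hi2 hi3]]] := side 0 => //.
- by rewrite subn0.
- move=> z; rewrite /between; have := dT z w (c n); have := dT (c 0) z (c n); lia.
have [|||z [j [hz1 hz2 hj1 hj2 hj3]]] := side n => //.
- by rewrite subnn /between; have := dC (c n) w; have := dC w (c 0); have := dC (c n) (c 0); lia.
- move=> z; rewrite /between; have := dC (c n) z; have := dC z w; have := dC (c n) w.
  by have := dT (c 0) w z; have := dT (c 0) z (c n); lia.
have hwyz : between d y z w.
  move: hy1 hz1; rewrite /between; have := dC (c n) z; have := dC z w; have := dC (c n) w.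
  have := dT y w z; have := dT y z (c n); have := dT (c 0) y (c n); lia.
have [w1 [hw1 hb1]] := sl _ _ (c i) _ hwyz.
case: hb1 => [/hi3|hb1].
  by have := dT w w1 w1; have := dT w w1 (c i); nia.
have [w2 [hw2 hb2]] := sl _ _ (c j) _ hb1.
have hww2 := dT w w1 w2.
case: hb2 => [hb2|hb2]; last first.
  have /hj3 : between d z (c j) w2.
    by move: hb2; rewrite /between; have := dC z w2; have := dC w2 (c j); have := dC z (c j); lia.
  by nia.
suff [k [hk1 hk2]] : exists k, k <= n /\ d w2 (c k) <= delta * N + L * 2.
  by have := hwm k hk1; have := dT w w2 (c k); nia.
have hcij : d (c i) (c j) <= 6 * m.
  have := dT (c i) y (c j); have := dT y z (c j); have := dT y w z.
  by have := dC (c i) y; have := dC w z; lia.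
have go i' j' : i' <= j' -> j' <= n -> d (c i') (c j') <= 6 * m ->
    between d (c i') (c j') w2 ->
  exists k, k <= n /\ d w2 (c k) <= delta * N + L * 2.
  move=> h1 h2 h3 h4.
  have [_ h5] := qg i' j' ltac:(lia).
  have h6 : j' - i' <= 2 ^ N by nia.
  have := @log_close d delta (L * 2) c N i' (j' - i') w2 dP sl h6.
  rewrite subnKC // => /(_ _ h4) [k hk|k [hk1 hk2]].
    by have [] := qg k k.+1 ltac:(lia); rewrite subSnn.
  by exists k; split=> //; lia.
have [hij|hij] := leqP i j; first exact: (go i j).
apply: (go j i) => //; first by lia.
  by rewrite dC.
by move: hb2; rewrite /between; have := dC (c j) w2; have := dC w2 (c i); have := dC (c j) (c i); lia.
Qed.

(** Second half of the Morse lemma.  Every point of the geodesic is close to a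
    point of [c] before or after [c i]; where this switches, two points of [c]
    on either side of [c i] are close to each other, hence also close in
    parameter. *)
Lemma quasi_geodesic_near_geodesic d delta L : geodesic_pmetric d ->
  slim d delta -> exists D1, forall (c : nat -> X) n i,
    quasi_geodesic d L c n -> i <= n ->
    exists w, between d (c 0) (c n) w /\ d (c i) w <= D1.
Proof.
move=> dP sl; have [dxx dC dT dM] := dP.
have [D0 hD0] := geodesic_near_quasi_geodesic L dP sl.
(* [E] bounds the number of steps of [c] between the two points where the switch
   happens. *)
pose E := L * (2 * D0 + 2).
exists (L * E.+1 + D0) => c n i qg hi.
have [g [g0 gn gs gb]] := geodesic_path (c 0) (c n) dP.
pose Q k := exists j, j <= i /\ d (g k) (c j) <= D0.
have Q0 : Q 0 by exists 0; rewrite g0 dxx.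
have fin k j j' : between d (c 0) (c n) (g k) -> j <= i -> i <= j' <= n ->
    d (g k) (c j) <= D0 -> d (c j) (c j') <= 2 * D0 + 1 ->
    exists w, between d (c 0) (c n) w /\ d (c i) w <= L * E.+1 + D0.
  move=> hb h1 h2 h3 h4; exists (g k); split=> //.
  have [_ h5] := qg j j' ltac:(lia).
  have [h6 _] := qg j i ltac:(lia).
  have h7 : i - j <= E by rewrite /E; nia.
  have h8 := dT (c i) (c j) (g k); rewrite (dC (c i) (c j)) (dC (c j) (g k)) in h8.
  by nia.
have [[j [h1 h2]]|[k [hk [j [h1 h2]] nQ]]] := nat_switch (d (c 0) (c n)).+1 Q0.
  apply: (fin (d (c 0) (c n)).+1 j n) => //; [exact: gb|lia|].
  by rewrite gn dC in h2; lia.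
have [j' [h3 h4]] := hD0 c n (g k.+1) qg (gb k.+1 hk).
have hij : i < j'.
  by rewrite ltnNge; apply/negP => hle; apply: nQ; exists j'.
apply: (fin k j j') => //; [apply: gb; lia|lia|].
have := dT (c j) (g k) (c j'); have := dT (g k) (g k.+1) (c j').
by have := gs k hk; have := dC (c j) (g k); lia.
Qed.

(** A path for [d2] that is at most [e] longer than the distance of its ends is
    nearly geodesic between any two of its points. *)
Lemma path_quasi_geodesic d1 d2 L (c : nat -> X) n e :
  geodesic_pmetric d2 ->
  (forall x y, d1 x y <= L * (d2 x y).+1) ->
  (forall x y, d2 x y <= L * (d1 x y).+1) ->
  (forall k, k < n -> d2 (c k) (c k.+1) <= 1) ->
  n <= d2 (c 0) (c n) + e ->
  quasi_geodesic d1 (L + e) c n.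
Proof.
move=> dP h12 h21 hs hn i j hij.
have [dxx dC dT dM] := dP.
have pl i' j' : i' <= j' <= n -> d2 (c i') (c j') <= j' - i'.
  by move=> h; apply: (path_length dP) => [|k hk]; [lia|apply: hs; lia].
have h1 := pl i j hij; have h2 := pl 0 i ltac:(lia); have h3 := pl j n ltac:(lia).
have h4 : j - i <= d2 (c i) (c j) + e.
  by have := dT (c 0) (c i) (c n); have := dT (c i) (c j) (c n); lia.
by have := h12 (c i) (c j); have := h21 (c i) (c j); nia.
Qed.

(** Geodesics for [d2] are quasi-geodesics for [d1], and so shadow the intervals
    of [d1] in both directions. *)
Lemma slim_quasi_isometry d1 d2 L :
  geodesic_pmetric d1 -> geodesic_pmetric d2 ->
  (forall x y, d1 x y <= L * (d2 x y).+1) ->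
  (forall x y, d2 x y <= L * (d1 x y).+1) ->
  (exists delta, slim d1 delta) -> exists delta, slim d2 delta.
Proof.
move=> dP1 dP2 h12 h21 [delta sl].
have [dxx1 dC1 dT1 dM1] := dP1; have [dxx2 dC2 dT2 dM2] := dP2.
have [D0 hD0] := geodesic_near_quasi_geodesic (L + 2) dP1 sl.
have [D1 hD1] := quasi_geodesic_near_geodesic (L + 2) dP1 sl.
exists (L * (D1 + delta + D0).+1) => x y t z hz.
have near1 : exists w, between d1 x y w /\ d1 z w <= D1.
  have [c1 [c10 c1n c1s _]] := geodesic_path x z dP2.
  have [c2 [c20 c2n c2s _]] := geodesic_path z y dP2.
  pose m := (d2 x z).+1; pose n := (d2 z y).+1.
  pose c k := if k <= m then c1 k else c2 (k - m).
  have c0 : c 0 = x by rewrite /c.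
  have cm : c m = z by rewrite /c leqnn.
  have cn : c (m + n) = y.
    by rewrite /c; case: ifP => [|_]; [lia|rewrite addKn].
  have qg : quasi_geodesic d1 (L + 2) c (m + n).
    apply: (path_quasi_geodesic dP2 h12 h21) => [k hk|]; last first.
      by rewrite c0 cn /m /n; move: hz; rewrite /between; lia.
    rewrite /c; have [hkm|hkm|hkm] := ltngtP k m.
    - by apply: c1s.
    - by rewrite subSn; [apply: c2s; lia|lia].
    by rewrite hkm subSnn -[c1 m]/(c1 _.+1) c1n -c20; apply: c2s.
  have [w] := hD1 c (m + n) m qg ltac:(lia).
  by rewrite c0 cm cn; exists w.
have near2 a b u : between d1 a b u -> exists v, between d2 a b v /\ d1 u v <= D0.
  move=> hu; have [c [c0 cn cs cb]] := geodesic_path a b dP2.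
  have qg : quasi_geodesic d1 (L + 2) c (d2 a b).+1.
    apply: (path_quasi_geodesic dP2 h12 h21) => [k hk|]; first exact: cs.
    by rewrite c0 cn; lia.
  have [|k [hk1 hk2]] := hD0 c _ u qg; first by rewrite c0 cn.
  by exists (c k); split=> //; apply: cb.
have [w [hw1 hw2]] := near1.
have [u [hu1 hu2]] := sl _ _ t _ hw1.
suff [v [hv1 hv2]] : exists v, d1 u v <= D0 /\ (between d2 x t v \/ between d2 t y v).
  exists v; split=> //; have := h21 z v.
  by have := dT1 z w v; have := dT1 w u v; nia.
by case: hu2 => /near2 [v [h1 h2]]; exists v; split=> //; [left|right].
Qed.

Definition hyperbolic_pmetric d := exists delta, four_point d delta.

Theorem hyperbolic_quasi_isometry d1 d2 L :
  geodesic_pmetric d1 -> geodesic_pmetric d2 ->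
  (forall x y, d1 x y <= L * (d2 x y).+1) ->
  (forall x y, d2 x y <= L * (d1 x y).+1) ->
  hyperbolic_pmetric d1 -> hyperbolic_pmetric d2.
Proof.
move=> dP1 dP2 h12 h21 [delta h].
have [|delta' h'] := slim_quasi_isometry dP1 dP2 h12 h21.
  by exists (delta + delta); apply: four_point_slim.
by exists (6 * delta' + 2); apply: slim_four_point.
Qed.

End IntegerMetrics.

(** * Word length relative to a subgroup *)

Section WordLength.
Variable G : groupType.
Implicit Types (H S : set G) (g x y : G).

(** These conditions make the number of factors from [S], counted modulo [H] on
    the right, a length function invariant under [H] on both sides. *)
Record length_system H S : Prop := {
  ls_subgroup : is_subgroup H ;
  ls_sub : H `<=` S ;
  ls_inv : forall x, S x -> S (x^-1)%g ;
  ls_mulr : forall x h, S x -> H h -> S (x * h)%g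
}.

Lemma subgroup1 H : is_subgroup H -> H 1%g. Proof. by case. Qed.

Lemma subgroupV H x : is_subgroup H -> H x -> H (x^-1)%g.
Proof. by move=> [h1 hd] hx; rewrite -[(x^-1)%g]mul1g; apply: hd. Qed.

Lemma subgroupM H x y : is_subgroup H -> H x -> H y -> H (x * y)%g.
Proof.
move=> hH hx hy; rewrite -[y]invgK; apply: (hH.2) => //.
exact: subgroupV.
Qed.

Fixpoint wball H S n : set G :=
  if n is n'.+1 then
    [set g | exists x s, [/\ wball H S n' x, S s & g = (x * s)%g]]
  else H.

(** Elements that are not products of elements of [S] get the value zero, so
    that length can be used in a group of which [S] generates a subgroup. *)
Definition wlen H S g : nat :=
  if pselect (exists n, `[< wball H S n g >]) is left e then ex_minn e else 0.

Definition wdist H S x y : nat := wlen H S (x^-1 * y)%g.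

Variables (H S : set G) (hHS : length_system H S).

Let hH : is_subgroup H := ls_subgroup hHS.
Let S1 : S 1%g := ls_sub hHS (subgroup1 hH).

Lemma wball_mulHr n x h : wball H S n x -> H h -> wball H S n (x * h)%g.
Proof.
case: n => [|n] /=; first exact: subgroupM.
move=> [y [s [hy hs ->]]] hh; exists y, (s * h)%g; split=> //.
  exact: (ls_mulr hHS).
by rewrite mulgA.
Qed.

Lemma wball_mul m n x y :
  wball H S m x -> wball H S n y -> wball H S (m + n) (x * y)%g.
Proof.
move=> hx; elim: n y => [|n IH] y; first by rewrite addn0; apply: wball_mulHr.
move=> [z [s [hz hs ->]]]; rewrite addnS; exists (x * z)%g, s.
by split=> //; [apply: IH|rewrite mulgA].
Qed.

Lemma wball_mono m n : m <= n -> wball H S m `<=` wball H S n.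
Proof.
move=> /subnK <-; rewrite addnC; elim: (n - m) => [|k IH] g hg.
  by rewrite addn0.
by rewrite addnS; exists g, 1%g; rewrite mulg1; split=> //; apply: IH.
Qed.

Lemma ls_mull h x : H h -> S x -> S (h * x)%g.
Proof.
move=> hh hx; rewrite -[(h * x)%g]invgK invgM; apply: (ls_inv hHS).
by apply: (ls_mulr hHS); [apply: (ls_inv hHS)|apply: subgroupV].
Qed.

Lemma wball1 : wball H S 1 = S.
Proof.
apply/seteqP; split=> g; first by move=> [h [s [hh hs ->]]]; apply: ls_mull.
by move=> hg; exists 1%g, g; rewrite mul1g; split=> //; apply: subgroup1.
Qed.

Lemma wball_inv n x : wball H S n x -> wball H S n (x^-1)%g.
Proof.
elim: n x => [|n IH] x; first exact: subgroupV.
move=> [y [s [hy hs ->]]]; rewrite invgM -[n.+1]add1n; apply: wball_mul.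
  by rewrite wball1; apply: (ls_inv hHS).
exact: IH.
Qed.

Lemma wball_split m n g : wball H S (m + n) g ->
  exists x y, [/\ wball H S m x, wball H S n y & g = (x * y)%g].
Proof.
elim: n g => [|n IH] g.
  rewrite addn0 => hg; exists g, 1%g; rewrite mulg1; split=> //.
  exact: subgroup1.
rewrite addnS => -[z [s [/IH [x [y [hx hy ->]]] hs ->]]].
by exists x, (y * s)%g; rewrite mulgA; split=> //; exists y, s.
Qed.

Definition reached g : Prop := exists n, wball H S n g.

Lemma wball_wlen g : reached g -> wball H S (wlen H S g) g.
Proof.
move=> hg; rewrite /wlen; case: pselect => [e|]; last first.
  by case: hg => n hn []; exists n; apply/asboolP.
by case: ex_minnP => n /asboolP.
Qed.

Lemma wlen_le n g : wball H S n g -> wlen H S g <= n.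
Proof.
move=> hg; rewrite /wlen; case: pselect => [e|//].
by case: ex_minnP => m _; apply; apply/asboolP.
Qed.

Lemma reachedM x y : reached x -> reached y -> reached (x * y)%g.
Proof. by move=> [m hm] [n hn]; exists (m + n); apply: wball_mul. Qed.

Lemma reachedV x : reached x -> reached (x^-1)%g.
Proof. by move=> [m hm]; exists m; apply: wball_inv. Qed.

Lemma reachedH h : H h -> reached h. Proof. by exists 0. Qed.

Lemma wlenH h : H h -> wlen H S h = 0.
Proof. by move=> hh; apply/eqP; rewrite -leqn0; apply: wlen_le. Qed.

Lemma wlenM x y : reached x -> reached y ->
  wlen H S (x * y)%g <= wlen H S x + wlen H S y.
Proof. by move=> hx hy; apply: wlen_le; apply: wball_mul; apply: wball_wlen. Qed.

Lemma wlenV x : reached x -> wlen H S (x^-1)%g = wlen H S x.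
Proof.
move=> hx; apply/eqP; rewrite eqn_leq; apply/andP; split.
  by apply: wlen_le; apply: wball_inv; apply: wball_wlen.
apply: wlen_le; rewrite -{2}[x]invgK; apply: wball_inv; apply: wball_wlen.
exact: reachedV.
Qed.

Lemma wlenHr x h : reached x -> H h -> wlen H S (x * h)%g = wlen H S x.
Proof.
move=> hx hh; apply/eqP; rewrite eqn_leq; apply/andP; split.
  by apply: wlen_le; apply: wball_mulHr => //; apply: wball_wlen.
apply: wlen_le; rewrite -{2}[x](mulgK h); apply: wball_mulHr.
  by apply: wball_wlen; apply: reachedM => //; apply: reachedH.
exact: subgroupV.
Qed.

Lemma wlenHl x h : reached x -> H h -> wlen H S (h * x)%g = wlen H S x.
Proof.
move=> hx hh; rewrite -wlenV; last by apply: reachedM => //; apply: reachedH.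
rewrite invgM wlenHr ?wlenV //; first exact: reachedV.
exact: subgroupV.
Qed.

Lemma wdistC x y : reached (x^-1 * y)%g -> wdist H S x y = wdist H S y x.
Proof. by move=> h; rewrite /wdist -wlenV // invgM invgK. Qed.

Lemma wdist_pmetric : (forall g, reached g) -> geodesic_pmetric (wdist H S).
Proof.
move=> gen; split.
- by move=> x; rewrite /wdist mulVg wlenH //; apply: subgroup1.
- by move=> x y; apply: wdistC.
- move=> x y z; rewrite /wdist.
  have -> : (x^-1 * z = (x^-1 * y) * (y^-1 * z))%g by rewrite mulgA mulgK.
  exact: wlenM.
- move=> x y k hk; have := wball_wlen (gen (x^-1 * y)%g).
  rewrite -/(wdist H S x y) -(subnKC hk) => /wball_split[a [b [ha hb hab]]].
  exists (x * a)%g; rewrite {1 2}/wdist mulKg.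
  have -> : ((x * a)^-1 * y = b)%g.
    by rewrite invgM -mulgA hab mulgA mulVg mul1g.
  have := wlen_le ha; have := wlen_le hb; have := wlenM (gen a) (gen b).
  by rewrite -hab -/(wdist H S x y); lia.
Qed.

Lemma wdist_mulHr x y h k : (forall g, reached g) -> H h -> H k ->
  wdist H S (x * h)%g (y * k)%g = wdist H S x y.
Proof.
move=> gen hh hk; rewrite /wdist invgM -mulgA.
rewrite wlenHl; [|exact: gen|exact: subgroupV hH hh].
by rewrite mulgA wlenHr.
Qed.

End WordLength.

Lemma wball_image (G1 G2 : groupType) (f : {multiplicative G1 -> G2})
    (H S : set G1) n g : injective f ->
  wball (f @` H) (f @` S) n (f g) <-> wball H S n g.
Proof.
move=> finj.
suff E : wball (f @` H) (f @` S) n = f @` wball H S n.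
  rewrite E; split; last by move=> h; exists g.
  by move=> [x hx /finj <-].
elim: n => [//|n IH] /=; rewrite IH; apply/seteqP; split=> y.
  move=> [_ [_ [[x hx <-] [s hs <-] ->]]]; exists (x * s)%g; last exact: gmulfM.
  by exists x, s.
move=> [_ [x [s [hx hs ->]]] <-]; exists (f x), (f s); rewrite gmulfM.
by split; [exists x|exists s|].
Qed.

Lemma wlen_image (G1 G2 : groupType) (f : {multiplicative G1 -> G2})
    (H S : set G1) g : injective f -> reached H S g ->
  wlen (f @` H) (f @` S) (f g) = wlen H S g.
Proof.
move=> finj hg; have bE n := wball_image H S n g finj.
have hfg : reached (f @` H) (f @` S) (f g) by case: hg => n hn; exists n; apply/bE.
apply/eqP; rewrite eqn_leq; apply/andP; split; apply: wlen_le.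
  by apply/bE; apply: wball_wlen.
by apply/bE; apply: wball_wlen.
Qed.

(** * Trees of blocks *)

Section TreeOfBlocks.
(** The two factors are indexed by booleans, so that the type of the next letter
    of a reduced word is [~~ b]. *)
Variables (G : groupType) (H : set G) (M S : bool -> set G).
Hypothesis HM : forall b, H `<=` M b.
Hypothesis Msub : forall b, is_subgroup (M b).
Hypothesis lsS : forall b, length_system H (S b).
Hypothesis genM : forall b x, M b x -> reached H (S b) x.

Let U := S false `|` S true.

Lemma length_system_union : length_system H U.
Proof.
split; first exact: ls_subgroup (lsS true).
- by move=> h hh; left; apply: (ls_sub (lsS false)).
- by move=> x [] hx; [left|right]; apply: (ls_inv (lsS _)).
- by move=> x h [] hx hh; [left|right]; apply: (ls_mulr (lsS _)).
Qed.

Fixpoint reduced (b : bool) (w : seq G) : Prop :=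
  if w is x :: w' then [/\ M b x, ~ H x & reduced (~~ b) w'] else True.

Fixpoint weight (b : bool) (w : seq G) : nat :=
  if w is x :: w' then wlen H (S b) x + weight (~~ b) w' else 0.

Definition gprod (w : seq G) : G := foldr (fun x y => x * y)%g 1%g w.

Hypothesis wlen_reduced :
  forall b w, reduced b w -> wlen H U (gprod w) = weight b w.
Hypothesis has_reduced : forall g,
  exists b w h, [/\ reduced b w, H h & g = (gprod w * h)%g].

Let hH : is_subgroup H := ls_subgroup (lsS true).
Let lsU : length_system H U := length_system_union.

Lemma notHV x : ~ H x -> ~ H (x^-1)%g.
Proof. by move=> hx hVx; apply: hx; rewrite -[x]invgK; apply: subgroupV. Qed.

Lemma wlenVM b x : M b x -> wlen H (S b) (x^-1)%g = wlen H (S b) x.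
Proof. by move=> hx; apply: wlenV => //; apply: genM. Qed.

(** The letters of [p] can be moved one by one, inverted, to the front of [q]:
    the word stays reduced because the types of the two words stay opposite. *)
Lemma wlen_opposite b p q : reduced b p -> reduced (~~ b) q ->
  wlen H U ((gprod p)^-1 * gprod q)%g = weight b p + weight (~~ b) q.
Proof.
elim: p b q => [|x p IH] b q; first by move=> _ hq; rewrite invg1 mul1g (wlen_reduced hq).
move=> [hx hxH hp] hq.
have -> : ((gprod (x :: p))^-1 * gprod q = (gprod p)^-1 * gprod (x^-1 :: q))%g.
  by rewrite /= invgM mulgA.
rewrite (IH (~~ b)) //= ?negbK ?wlenVM //; first lia.
by split=> //; [apply: subgroupV|apply: notHV].
Qed.

(** Two words that part within one block: their distance is the sum of the two
    tails and of the distance in the block. *)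
Lemma wlen_fork b u p v q : reduced b (u :: p) -> reduced b (v :: q) ->
  ~ H (u^-1 * v)%g ->
  wlen H U ((gprod (u :: p))^-1 * gprod (v :: q))%g =
    weight (~~ b) p + wlen H (S b) (u^-1 * v)%g + weight (~~ b) q.
Proof.
move=> [hu _ hp] [hv _ hq] huv.
have -> : ((gprod (u :: p))^-1 * gprod (v :: q) =
          (gprod p)^-1 * gprod ((u^-1 * v) :: q))%g.
  by rewrite /= invgM !mulgA.
rewrite (wlen_opposite hp) /= ?negbK //; first lia.
by split=> //; apply: subgroupM => //; apply: subgroupV.
Qed.

Definition separate b (p : seq G) (b' : bool) (q : seq G) : bool :=
  [|| b != b', nilp p | nilp q].

Lemma wlen_separate b p b' q : reduced b p -> reduced b' q ->
  separate b p b' q ->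
  wlen H U ((gprod p)^-1 * gprod q)%g = weight b p + weight b' q.
Proof.
move=> hp hq; rewrite /separate.
have [bb'|bb'] := eqVneq b b'; last first.
  have E : b' = ~~ b by case: b b' bb' {hp hq} => -[].
  by move=> _; rewrite E; apply: wlen_opposite; rewrite -?E.
rewrite -{b'}bb' in hq *.
rewrite /=; case: p hp => [|x p] hp.
  by move=> _; rewrite invg1 mul1g add0n; apply: wlen_reduced.
rewrite /=; case: q {hq} => [|//] _.
exact: (@wlen_opposite b _ [::] hp I).
Qed.

Lemma reached_all g : reached H U g.
Proof.
have [b [w [h [hw hh ->]]]] := has_reduced g.
apply: (reachedM lsU); last exact: reachedH hh.
elim: w b hw {g} => [|x w IH] b /=; first by move=> _; apply/reachedH/(subgroup1 hH).
move=> [/genM [n hn] _ /IH hw]; apply: (reachedM lsU) => //; exists n.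
elim: n x hn => [//|n IHn] x [y [s [/IHn hy hs ->]]]; exists y, s; split=> //.
by case: b hs {IHn} => hs; [right|left].
Qed.

(** Left multiplication by [h] in [H], with the element that remains when [q] is
    empty dropped on the right, where lengths do not see it. *)
Definition absorb h (q : seq G) := if q is y :: q' then (h * y)%g :: q' else [::].

Lemma absorbP b q h : reduced b q -> H h ->
  [/\ reduced b (absorb h q), weight b (absorb h q) = weight b q,
      size (absorb h q) = size q &
      exists2 k, H k & (h * gprod q = gprod (absorb h q) * k)%g].
Proof.
case: q => [|y q] hq hh /=.
  by split=> //; exists h => //; rewrite mulg1 mul1g.
case: hq => hy hyH hq; split=> //.
- split=> //; first by apply: subgroupM => //; apply: HM.
  move=> hhy; apply: hyH; rewrite -[y](mulKg h); apply: subgroupM => //.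
  exact: subgroupV.
- by rewrite wlenHl //; apply: genM.
- by exists 1%g; [apply: subgroup1|rewrite mulg1 mulgA].
Qed.

Lemma wdistH x y h k : H h -> H k ->
  wdist H U (x * h)%g (y * k)%g = wdist H U x y.
Proof. by apply: wdist_mulHr; [exact: lsU|exact: reached_all]. Qed.

Definition four_point_on (M : set G) (d : G -> G -> nat) delta := forall x y z w,
  M x -> M y -> M z -> M w ->
  d x z + d y w <= maxn (d x y + d z w) (d y z + d x w) + delta.

Lemma wlen_block b g : M b g -> wlen H U g = wlen H (S b) g.
Proof.
move=> hg; have [hgH|hgH] := pselect (H g); first by rewrite !wlenH.
have -> : g = gprod [:: g] by rewrite /gprod /= mulg1.
rewrite (@wlen_reduced b) //= addn0 /gprod /= ?mulg1 //.
Qed.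

Lemma four_point_blocks delta : four_point (wdist H U) delta ->
  forall b, four_point_on (M b) (wdist H (S b)) delta.
Proof.
move=> h b x y z w hx hy hz hw; have := h x y z w.
have Mdiv a c : M b a -> M b c -> M b (a^-1 * c)%g.
  by move=> ha hc; apply: subgroupM => //; apply: subgroupV.
by rewrite /wdist !(@wlen_block b) //; apply: Mdiv.
Qed.

Definition four_point_at1 delta x y z :=
  wdist H U x z + wlen H U y <=
  maxn (wdist H U x y + wlen H U z) (wdist H U y z + wlen H U x) + delta.

(** Induction on the first word.  If the words have different types, or one of
    them is empty, at least two of the three pairs are separated at the identity
    and the inequality is additivity of length.  Otherwise compare the first
    letters modulo [H]: if they all agree they are removed; if exactly two agree
    the third point is separated from both at the same vertex; if no two agree
    the inequality is the one of the block, for the first letters and the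
    identity. *)
Lemma four_point_words delta :
  (forall b, four_point_on (M b) (wdist H (S b)) delta) ->
  forall n b1 p1 b2 p2 b3 p3, size p1 <= n ->
  reduced b1 p1 -> reduced b2 p2 -> reduced b3 p3 ->
  four_point_at1 delta (gprod p1) (gprod p2) (gprod p3).
Proof.
move=> h4; have uP := wdist_pmetric lsU reached_all.
have [dxx dC dT dM] := uP.
elim=> [|n IH] b1 p1 b2 p2 b3 p3 hn h1 h2 h3.
- case: p1 hn h1 => // _ _; rewrite /four_point_at1 /wdist.
  by rewrite /= invg1 !mul1g (wlenH U (subgroup1 hH)); lia.
have leX x y : wdist H U x y <= wlen H U x + wlen H U y.
  by rewrite /wdist -(wlenV lsU (reached_all x)); apply: (wlenM lsU); apply: reached_all.
have [] := boolP [&& separate b1 p1 b2 p2 || separate b1 p1 b3 p3,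
   separate b1 p1 b2 p2 || separate b2 p2 b3 p3 & 
   separate b1 p1 b3 p3 || separate b2 p2 b3 p3].
  have s12 := wlen_separate h1 h2; have s13 := wlen_separate h1 h3.
  have s23 := wlen_separate h2 h3.
  rewrite /four_point_at1; move: (leX (gprod p1) (gprod p2)).
  move: (leX (gprod p1) (gprod p3)) (leX (gprod p2) (gprod p3)).
  move: s12 s13 s23; rewrite /wdist.
  rewrite (wlen_reduced h1) (wlen_reduced h2) (wlen_reduced h3).
  case: separate; case: separate; case: separate => //= s12 s13 s23 l13 l23 l12 _;
   try (have := s12 isT); try (have := s13 isT); try (have := s23 isT); lia.
rewrite /separate.
case: p1 hn h1 => [|u p]; first by rewrite !orbT.
case: p2 h2 => [|v q]; first by rewrite !orbT.
case: p3 h3 => [|t r]; first by rewrite !orbT.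
rewrite /= !orbF => h3 h2 hn h1 hb.
have [E2 E3] : b2 = b1 /\ b3 = b1 by move: hb; case: (b1) (b2) (b3) => -[] [].
clear hb; subst b2 b3; rename b1 into b.
have {}h1 : reduced b (u :: p) by [].
have {}h2 : reduced b (v :: q) by [].
have {}h3 : reduced b (t :: r) by [].
have [hu huH hp] := h1; have [hv hvH hq] := h2; have [ht htH hr] := h3.
have Mdiv x y : M b x -> M b y -> M b (x^-1 * y)%g.
  by move=> ? ?; apply: subgroupM => //; apply: subgroupV.
have Hdiv x y : H (x^-1 * y)%g -> H (y^-1 * x)%g.
  by move=> hxy; rewrite -[(y^-1 * x)%g]invgK invgM invgK; apply: subgroupV.
have Htr x y z : H (x^-1 * y)%g -> H (y^-1 * z)%g -> H (x^-1 * z)%g.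
  move=> hxy hyz; have -> : (x^-1 * z = (x^-1 * y) * (y^-1 * z))%g by rewrite mulgA mulgK.
  exact: subgroupM.
have lM x y : M b x -> H (x^-1 * y)%g -> wlen H (S b) x = wlen H (S b) y.
  move=> hx hxy; rewrite -[y](mulVKg x) wlenHr //; exact: genM.
have lT x y : M b x -> M b y -> 
   wlen H (S b) y <= wlen H (S b) x + wlen H (S b) (x^-1 * y)%g.
  move=> hx hy; rewrite -{1}[y](mulVKg x).
  by apply: (wlenM (lsS b)); apply: genM => //; apply: Mdiv.
have lC x y z : M b x -> M b y -> M b z -> H (x^-1 * y)%g ->
    wlen H (S b) (x^-1 * z)%g = wlen H (S b) (y^-1 * z)%g.
  move=> hx hy hz hxy.
  have -> : (x^-1 * z = (x^-1 * y) * (y^-1 * z))%g by rewrite mulgA mulgK.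
  by rewrite wlenHl //; apply: genM; apply: Mdiv.
have lS x y : M b x -> M b y -> 
    wlen H (S b) (x^-1 * y)%g = wlen H (S b) (y^-1 * x)%g.
  by move=> hx hy; rewrite -wlenVM ?invgM ?invgK //; apply: Mdiv.
have w1 := wlen_reduced h1; have w2 := wlen_reduced h2; have w3 := wlen_reduced h3.
have [huv|huv] := pselect (H (u^-1 * v)%g).
  have [hut|hut] := pselect (H (u^-1 * t)%g).
    have [rq wq sq [kq hkq eq]] := absorbP hq huv.
    have [rr wr sr [kr hkr er]] := absorbP hr hut.
    have k1 : H 1%g := subgroup1 hH.
    have := IH _ p _ _ _ _ hn hp rq rr; rewrite /four_point_at1.
    have E12 : wdist H U (gprod (u :: p)) (gprod (v :: q)) =
               wdist H U (gprod p) (gprod (absorb (u^-1 * v) q)).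
      rewrite -[RHS](wdistH _ _ k1 hkq) -eq mulg1 /wdist /= invgM !mulgA //.
    have E13 : wdist H U (gprod (u :: p)) (gprod (t :: r)) =
               wdist H U (gprod p) (gprod (absorb (u^-1 * t) r)).
      rewrite -[RHS](wdistH _ _ k1 hkr) -er mulg1 /wdist /= invgM !mulgA //.
    have E23 : wdist H U (gprod (v :: q)) (gprod (t :: r)) =
               wdist H U (gprod (absorb (u^-1 * v) q)) (gprod (absorb (u^-1 * t) r)).
      rewrite -[RHS](wdistH _ _ hkq hkr) -er -eq /wdist /= !invgM invgK !mulgA mulgK //.
    rewrite -E12 -E13 -E23 w1 w2 w3 /= (wlen_reduced rq) (wlen_reduced rr).
    rewrite (wlen_reduced hp) wq wr.
    by have := lM u v hu huv; have := lM u t hu hut; lia.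
  have hvt : ~ H (v^-1 * t)%g by move=> h; apply: hut; apply: Htr huv h.
  rewrite /four_point_at1 /wdist (wlen_fork h1 h3 hut) (wlen_fork h2 h3 hvt).
  rewrite w1 w2 w3 /=; have := lM u v hu huv; have := lC u v t hu hv ht huv; lia.
have [hut|hut] := pselect (H (u^-1 * t)%g).
  have hvt : ~ H (v^-1 * t)%g.
    by move=> h; apply: huv; apply: Htr hut _; apply: Hdiv.
  have [rr wr sr [kr hkr er]] := absorbP hr hut.
  have k1 : H 1%g := subgroup1 hH.
  have E13 : wdist H U (gprod (u :: p)) (gprod (t :: r)) =
             wdist H U (gprod p) (gprod (absorb (u^-1 * t) r)).
    rewrite -[RHS](wdistH _ _ k1 hkr) -er mulg1 /wdist /= invgM !mulgA //.
  rewrite /four_point_at1 E13.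
  have := leX (gprod p) (gprod (absorb (u^-1 * t) r)).
  rewrite (wlen_reduced hp) (wlen_reduced rr) wr.
  rewrite /wdist (wlen_fork h1 h2 huv) (wlen_fork h2 h3 hvt).
  rewrite w1 w2 w3 /=; have := lM u t hu hut.
  by have := lT u v hu hv; lia.
have [hvt|hvt] := pselect (H (v^-1 * t)%g).
  rewrite /four_point_at1 /wdist (wlen_fork h1 h2 huv) (wlen_fork h1 h3 hut).
  rewrite w1 w2 w3 /=; have := lM v t hv hvt.
  have := lC v t u hv ht hu hvt; have := lS u v hu hv; have := lS u t hu ht.
  lia.
rewrite /four_point_at1 /wdist (wlen_fork h1 h2 huv) (wlen_fork h1 h3 hut).
rewrite (wlen_fork h2 h3 hvt) w1 w2 w3 /=.
have := h4 b u v t 1%g hu hv ht (subgroup1 (Msub b)).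
rewrite /wdist !mulg1 (wlenVM hu) (wlenVM hv) (wlenVM ht); lia.
Qed.

Lemma four_point_of_blocks delta :
  (forall b, four_point_on (M b) (wdist H (S b)) delta) ->
  four_point (wdist H U) delta.
Proof.
move=> h4 x y z w; have [dxx dC dT dM] := wdist_pmetric lsU reached_all.
have E a : exists b p h, [/\ reduced b p, H h & (w^-1 * a = gprod p * h)%g].
  exact: has_reduced.
have [b1 [p1 [k1 [r1 hk1 e1]]]] := E x.
have [b2 [p2 [k2 [r2 hk2 e2]]]] := E y.
have [b3 [p3 [k3 [r3 hk3 e3]]]] := E z.
have dE a b p k q l : H k -> H l -> (w^-1 * a = gprod p * k)%g ->
    (w^-1 * b = gprod q * l)%g ->
    wdist H U a b = wdist H U (gprod p) (gprod q).
  move=> hk hl ea eb; rewrite -[RHS](wdistH _ _ hk hl) -ea -eb /wdist.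
  by rewrite invgM invgK !mulgA mulgK.
have dw a p k : H k -> (w^-1 * a = gprod p * k)%g ->
    wdist H U a w = wlen H U (gprod p).
  move=> hk ea; rewrite dC /wdist ea wlenHr //; exact: reached_all.
rewrite (dE _ _ _ _ _ _ hk1 hk3 e1 e3) (dE _ _ _ _ _ _ hk1 hk2 e1 e2).
rewrite (dE _ _ _ _ _ _ hk2 hk3 e2 e3) (dw _ _ _ hk1 e1) (dw _ _ _ hk2 e2).
rewrite (dw _ _ _ hk3 e3).
exact: (four_point_words h4 (leqnn _) r1 r2 r3).
Qed.

End TreeOfBlocks.

(** * Bijections and pushouts of groups *)

Lemma mulmorph1 (G1 G2 : groupType) (f : {multiplicative G1 -> G2}) : f 1%g = 1%g.
Proof. by apply: (mulgI (f 1%g)); rewrite -gmulfM !mulg1. Qed.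

Lemma mulmorphV (G1 G2 : groupType) (f : {multiplicative G1 -> G2}) x :
  f (x^-1)%g = ((f x)^-1)%g.
Proof. by apply: (mulgI (f x)); rewrite -gmulfM !mulgV mulmorph1. Qed.

Section Bijections.
Variable T : Type.

Record bijection := Bijection {
  bfun : T -> T ; binv : T -> T ;
  bfunK : cancel bfun binv ; binvK : cancel binv bfun
}.

Lemma bijectionP (f g : bijection) : bfun f =1 bfun g -> f = g.
Proof.
case: f g => [f f' fK f'K] [g g' gK g'K] /= /funext e; subst g.
have e' : f' = g' by apply/funext => x; rewrite -{1}[x]g'K fK.
by subst g'; congr Bijection; apply: Prop_irrelevance.
Qed.

HB.instance Definition _ := gen_eqMixin bijection.
HB.instance Definition _ := gen_choiceMixin bijection.

Definition bij_one : bijection := @Bijection id id (fun=> erefl) (fun=> erefl).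
Definition bij_inv (f : bijection) : bijection := Bijection (binvK f) (bfunK f).
Definition bij_mul (f g : bijection) : bijection :=
  @Bijection (bfun f \o bfun g) (binv g \o binv f)
    (can_comp (bfunK f) (bfunK g)) (can_comp (binvK g) (binvK f)).

Fact bij_mulA : associative bij_mul. Proof. by move=> f g h; apply: bijectionP. Qed.
Fact bij_mul1 : left_id bij_one bij_mul. Proof. by move=> f; apply: bijectionP. Qed.
Fact bij_1mul : right_id bij_one bij_mul. Proof. by move=> f; apply: bijectionP. Qed.
Fact bij_mulV : left_inverse bij_one bij_inv bij_mul.
Proof. by move=> f; apply: bijectionP => x /=; rewrite bfunK. Qed.
Fact bij_Vmul : right_inverse bij_one bij_inv bij_mul.
Proof. by move=> f; apply: bijectionP => x /=; rewrite binvK. Qed.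

HB.instance Definition _ :=
  isGroup.Build bijection bij_mulA bij_mul1 bij_1mul bij_mulV bij_Vmul.

Section Action.
Variables (G : groupType) (act : G -> T -> T).
Hypothesis act1 : forall t, act 1%g t = t.
Hypothesis actM : forall g h t, act (g * h)%g t = act g (act h t).

Fact act_can g : cancel (act g) (act g^-1%g).
Proof. by move=> t; rewrite -actM mulVg act1. Qed.

Fact act_canV g : cancel (act g^-1%g) (act g).
Proof. by move=> t; rewrite -actM mulgV act1. Qed.

Definition bij_act g : bijection := Bijection (act_can g) (act_canV g).

Lemma action_morphism : exists f : {multiplicative G -> bijection},
  forall g t, bfun (f g) t = act g t.
Proof.
have fM : {morph bij_act : g h / (g * h)%g}.
  by move=> g h; apply: bijectionP => t /=; rewrite actM.
pose F := isMultiplicative.Build G bijection bij_act fM.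
pose f : {multiplicative G -> bijection} := HB.pack bij_act F.
by exists f.
Qed.

End Action.
End Bijections.

Definition is_pushout (A B C G : groupType) (iA : {multiplicative C -> A})
    (iB : {multiplicative C -> B}) (jA : {multiplicative A -> G})
    (jB : {multiplicative B -> G}) : Prop :=
  forall (H : groupType)
      (f : {multiplicative A -> H}) (g : {multiplicative B -> H}),
    (forall c, f (iA c) = g (iB c)) ->
    exists h : {multiplicative G -> H},
      [/\ forall a, h (jA a) = f a, forall b, h (jB b) = g b &
          forall h' : {multiplicative G -> H},
            (forall a, h' (jA a) = f a) -> (forall b, h' (jB b) = g b) ->
            h' =1 h].

Section Pushout.
Variables (A B C G : groupType) (iA : {multiplicative C -> A})
  (iB : {multiplicative C -> B}) (jA : {multiplicative A -> G})
  (jB : {multiplicative B -> G}).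
Hypothesis glue : forall c, jA (iA c) = jB (iB c).
Hypothesis universal : is_pushout iA iB jA jB.

Lemma pushout_ext (H : groupType) (h1 h2 : {multiplicative G -> H}) :
  (forall a, h1 (jA a) = h2 (jA a)) -> (forall b, h1 (jB b) = h2 (jB b)) ->
  h1 =1 h2.
Proof.
move=> eA eB.
have fM : {morph (h2 \o jA) : x y / (x * y)%g} by move=> x y /=; rewrite !gmulfM.
have gM : {morph (h2 \o jB) : x y / (x * y)%g} by move=> x y /=; rewrite !gmulfM.
pose F := isMultiplicative.Build A H (h2 \o jA) fM.
pose f : {multiplicative A -> H} := HB.pack (h2 \o jA) F.
pose F' := isMultiplicative.Build B H (h2 \o jB) gM.
pose g : {multiplicative B -> H} := HB.pack (h2 \o jB) F'.
have [c|h [_ _ hu]] := universal (f := f) (g := g).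
  by rewrite /= glue.
by move=> x; rewrite (hu h1) // (hu h2).
Qed.

(** Let [G] act on the subsets of [G] and one extra point, and conjugate this
    action by the involution exchanging [P] and the extra point.  If [P]
    contains both factors the two actions agree on them, hence on [G]; so the
    translate of [P] by any [g] is [P]. *)
Lemma pushout_generated (P : set G) : is_subgroup P ->
  (forall a, P (jA a)) -> (forall b, P (jB b)) -> forall g, P g.
Proof.
move=> hP PA PB.
pose tr (g : G) (X : option (set G)) :=
  if X is Some Y then Some [set x | Y (g^-1 * x)%g] else None.
have tr1 X : tr 1%g X = X.
  case: X => //= Y; congr Some; apply/seteqP; split=> x /=;
  by rewrite invg1 mul1g.
have trM g h X : tr (g * h)%g X = tr g (tr h X).
  case: X => //= Y; congr Some; apply/seteqP; split=> x /=;
  by rewrite invgM !mulgA.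
pose sw (X : option (set G)) :=
  if X is Some Y then (if `[< Y = P >] then None else Some Y) else Some P.
have swP : sw (Some P) = None by rewrite /sw asboolT.
have swN : sw None = Some P by [].
have trN g : tr g None = None by [].
have swO Y : Y <> P -> sw (Some Y) = Some Y by move=> nY; rewrite /sw asboolF.
have swK X : sw (sw X) = X.
  case: X => [Y|]; last exact: swP.
  by have [->|nY] := pselect (Y = P); [rewrite swP|rewrite !swO].
have [h1 h1E] := action_morphism tr1 trM.
pose tr2 g X := sw (tr g (sw X)).
have [||h2 h2E] := @action_morphism _ G tr2.
- by move=> X; rewrite /tr2 tr1 swK.
- by move=> g h X; rewrite /tr2 swK trM.
have trP x : P x -> tr x (Some P) = Some P.
  move=> hx; congr Some; apply/seteqP; split=> y /= hy.
    by rewrite -[y](mulVKg x); apply: subgroupM.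
  by apply: subgroupM => //; apply: subgroupV.
have comm x : P x -> h1 x = h2 x.
  move=> hx; apply: bijectionP => X; rewrite h1E h2E /tr2.
  case: X => [Y|]; last by rewrite swN trP // swP trN.
  have [->|nY] := pselect (Y = P); first by rewrite trP // swP.
  rewrite (swO _ nY) [tr x _]/= swO // => e; apply: nY.
  have := tr1 (Some Y); rewrite -(mulVg x) trM [tr x _]/= e trP.
    by case.
  exact: subgroupV.
have e := pushout_ext (fun a => comm _ (PA a)) (fun b => comm _ (PB b)).
move=> g; have := congr1 (fun f => bfun f (Some P)) (e g).
rewrite h1E h2E /tr2 swP trN swN => -[/(congr1 (fun X => X g))] /=.
by rewrite mulVg => <-; apply: subgroup1.
Qed.
End Pushout.

(** * Normal forms in an amalgam *)

(** A factor [X] of the amalgam acts on pairs of an element of [C] and a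
    sequence over an alphabet [T] that contains [X].  The pair [(c, s)] stands
    for the product of [c] and of the letters of [s], each letter being the
    chosen representative of a coset [C x]. *)
Section FactorAction.
Variables (C X : groupType) (i : {multiplicative C -> X}) (T : Type).
Variables (inj : X -> T) (prj : T -> option X).
Hypothesis i_inj : injective i.
Hypothesis prjK : pcancel inj prj.
Hypothesis prjKV : forall t x, prj t = Some x -> t = inj x.

Definition crep x : X :=
  if `[< range i x >] then 1%g else xget 1%g [set y | exists c, y = (i c * x)%g].

Definition ccof x : C := xget 1%g [set c | x = (i c * crep x)%g].

Lemma ccofE x : x = (i (ccof x) * crep x)%g.
Proof.
apply: (@xgetPex _ _ [set c | x = (i c * crep x)%g]) => /=.
rewrite /crep; case: asboolP => [[c _ <-]|_]; first by exists c; rewrite mulg1.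
case: xgetP => [y _ [c ->]|h'].
  by exists (c^-1)%g; rewrite mulgA -gmulfM mulVg mulmorph1 mul1g.
by case: (h' x); exists 1%g; rewrite mulmorph1 mul1g.
Qed.

Lemma crep_range x : range i x -> crep x = 1%g.
Proof. by move=> hx; rewrite /crep asboolT. Qed.

Lemma range_crep x : crep x = 1%g -> range i x.
Proof. by move=> hx; exists (ccof x) => //; rewrite [RHS]ccofE hx mulg1. Qed.

Lemma crepMl c x : crep (i c * x)%g = crep x.
Proof.
rewrite /crep.
have -> : `[< range i (i c * x)%g >] = `[< range i x >].
  apply: asbool_equiv_eq; split=> -[d _ e].
    by exists (c^-1 * d)%g => //; rewrite gmulfM e mulgA -gmulfM mulVg mulmorph1 mul1g.
  by exists (c * d)%g => //; rewrite gmulfM e.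
have -> // : [set y | exists c', y = (i c' * (i c * x))%g] =
            [set y | exists c', y = (i c' * x)%g].
apply/seteqP; split=> y [d ->].
  by exists (d * c)%g; rewrite gmulfM mulgA.
by exists (d * c^-1)%g; rewrite mulgA -gmulfM mulgVK.
Qed.

Lemma crep_id x : crep (crep x) = crep x.
Proof. by rewrite {2}[x]ccofE crepMl. Qed.

Lemma ccofMl c x : ccof (i c * x)%g = (c * ccof x)%g.
Proof.
apply: i_inj; apply: (mulIg (crep x)); rewrite -{1}(crepMl c) -ccofE.
by rewrite gmulfM -mulgA -ccofE.
Qed.

Lemma ccof_crep x : crep x = x -> ccof x = 1%g.
Proof.
move=> hx; apply: i_inj; apply: (mulIg (crep x)).
by rewrite -ccofE mulmorph1 mul1g.
Qed.

(** The letters allowed for [X]: representatives of the non-trivial cosets. *)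
Definition letter x : bool := (crep x == x) && (x != 1%g).

(** Every sequence, reduced or not, is to be decomposed uniquely as a
    representative in front of a sequence [s] satisfying [unled].  For this the
    recursion must alternate along a run of letters of [X]: a letter counts as a
    leading one exactly if the rest has none. *)
Fixpoint unled (s : seq T) : bool :=
  if s is t :: s' then
    if prj t is Some x then ~~ (letter x && unled s') else true
  else true.

Definition lead (s : seq T) : X :=
  if unled s then 1%g else if s is t :: _ then odflt 1%g (prj t) else 1%g.

Definition unlead (s : seq T) : seq T := if unled s then s else behead s.

Definition attach x (s : seq T) : seq T := if x == 1%g then s else inj x :: s.

Lemma unled_unlead s : unled (unlead s).
Proof.
rewrite /unlead; case: ifP => //; case: s => //= t s.
by case: (prj t) => // x; move/negbFE/andP => [].
Qed.

Lemma crep_lead s : crep (lead s) = lead s.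
Proof.
have crep1 : crep 1%g = 1%g by apply: crep_range; exists 1%g; rewrite ?mulmorph1.
rewrite /lead; case: ifP => //; case: s => //= t s.
by case: (prj t) => // x; move/negbFE/andP => [/andP[/eqP]].
Qed.

Lemma attach_lead s : attach (lead s) (unlead s) = s.
Proof.
rewrite /lead /unlead; case hs: (unled s); first by rewrite /attach eqxx.
case: s hs => //= t s; case ht : (prj t) => [x|//] /=.
move/negbFE/andP => [/andP[_ /negbTE hx] _].
by rewrite /attach hx (prjKV ht).
Qed.

Lemma unled_attach x s : crep x = x -> unled s ->
  unled (attach x s) = (x == 1%g).
Proof.
move=> hx hs; rewrite /attach; case: ifP => //= hx1.
by rewrite prjK /letter hx eqxx hx1 hs.
Qed.

Lemma lead_attach x s : crep x = x -> unled s -> lead (attach x s) = x.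
Proof.
move=> hx hs; rewrite /lead unled_attach // /attach.
by case: eqP => [->|_] //=; rewrite prjK.
Qed.

Lemma unlead_attach x s : crep x = x -> unled s -> unlead (attach x s) = s.
Proof.
by move=> hx hs; rewrite /unlead unled_attach // /attach; case: eqP.
Qed.

Definition factor_act (x : X) (o : C * seq T) : C * seq T :=
  let y := (x * i o.1 * lead o.2)%g in (ccof y, attach (crep y) (unlead o.2)).

Lemma factor_act_range c o : factor_act (i c) o = ((c * o.1)%g, o.2).
Proof.
rewrite /factor_act -gmulfM ccofMl crepMl crep_lead attach_lead ccof_crep ?mulg1 //.
exact: crep_lead.
Qed.

Lemma factor_act1 o : factor_act 1%g o = o.
Proof. by rewrite -(mulmorph1 i) factor_act_range mul1g; case: o. Qed.

(** Decomposing the result of an action returns the element [x * i c * lead s]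
    of [X] on which left multiplication takes place. *)
Lemma factor_actM x y o : factor_act (x * y)%g o = factor_act x (factor_act y o).
Proof.
rewrite {2}/factor_act {2}/factor_act /=.
rewrite lead_attach ?crep_id ?unled_unlead // unlead_attach ?crep_id ?unled_unlead //.
by rewrite -(mulgA x) -ccofE /factor_act !mulgA.
Qed.

Section Weight.
Variables (wT : T -> nat) (wX : X -> nat).
Hypothesis wTE : forall x, wT (inj x) = wX x.
Hypothesis wX1 : wX 1%g = 0.
Hypothesis wXl : forall c x, wX (i c * x)%g = wX x.

Definition tally (s : seq T) : nat := sumn (map wT s).

Lemma wX_crep x : wX (crep x) = wX x.
Proof. by rewrite [in RHS](ccofE x) wXl. Qed.

Lemma tally_attach x s : tally (attach x s) = wX x + tally s.
Proof. by rewrite /attach; case: eqP => [->|_]; rewrite ?wX1 /tally //= wTE. Qed.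

Lemma tally_factor_act x o : tally (factor_act x o).2 =
  wX (x * i o.1 * lead o.2)%g + tally (unlead o.2).
Proof. by rewrite tally_attach wX_crep. Qed.

Lemma tally_lead s : tally s = wX (lead s) + tally (unlead s).
Proof. by rewrite -{1}(attach_lead s) tally_attach. Qed.

Hypothesis wXr : forall c x, wX (x * i c)%g = wX x.

(** Acting from outside [C] on a sequence without leading letter adds one letter
    and the weight of [x]. *)
Lemma factor_act_unled x o : unled o.2 -> ~ range i x ->
  exists y, (factor_act x o).2 = inj y :: o.2 /\ tally (factor_act x o).2 = wX x + tally o.2.
Proof.
move=> ho hx; rewrite tally_factor_act /factor_act /lead /unlead ho mulg1 /=.
set y := (x * i o.1)%g; exists (crep y); rewrite wXr; split=> //.
rewrite /attach; case: eqP => // /range_crep[c _ hc]; case: hx.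
by exists (c * o.1^-1)%g => //; rewrite gmulfM hc mulmorphV mulgK.
Qed.

End Weight.
End FactorAction.

Section ReducedWords.
Variables (A B C G : groupType) (iA : {multiplicative C -> A})
  (iB : {multiplicative C -> B}) (jA : {multiplicative A -> G})
  (jB : {multiplicative B -> G}).
Hypothesis glue : forall c, jA (iA c) = jB (iB c).
Hypothesis universal : is_pushout iA iB jA jB.
Hypotheses (iA_inj : injective iA) (iB_inj : injective iB).
Hypotheses (jA_inj : injective jA) (jB_inj : injective jB).
Variables (SA : set A) (SB : set B).
Hypothesis lsA : length_system (range iA) SA.
Hypothesis lsB : length_system (range iB) SB.
Hypothesis reachA : forall a, reached (range iA) SA a.
Hypothesis reachB : forall b, reached (range iB) SB b.

Definition amalgam_core : set G := jA @` range iA.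
Definition amalgam_factor (b : bool) : set G := if b then range jB else range jA.
Definition amalgam_steps (b : bool) : set G := if b then jB @` SB else jA @` SA.

Local Notation H := amalgam_core.
Local Notation M := amalgam_factor.
Local Notation S := amalgam_steps.
Local Notation U := (S false `|` S true).

Lemma amalgam_coreE : H = jB @` range iB.
Proof.
apply/seteqP; split=> _ [_ [c _ <-] <-].
  by exists (iB c); [exists c|rewrite glue].
by exists (iA c); [exists c|rewrite glue].
Qed.

Lemma range_subgroup (G1 G2 : groupType) (f : {multiplicative G1 -> G2}) :
  is_subgroup (range f).
Proof.
split; first by exists 1%g; rewrite ?mulmorph1.
by move=> _ _ [x _ <-] [y _ <-]; exists (x * y^-1)%g; rewrite // gmulfM mulmorphV.
Qed.

Lemma length_system_image (G1 G2 : groupType) (f : {multiplicative G1 -> G2}) H' S' :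
  length_system H' S' -> length_system (f @` H') (f @` S').
Proof.
move=> [[h1 hd] hs hv hm]; split.
- split; first by exists 1%g; rewrite ?mulmorph1.
  move=> _ _ [x hx <-] [y hy <-]; exists (x * y^-1)%g; first exact: hd.
  by rewrite gmulfM mulmorphV.
- by move=> _ [x hx <-]; exists x => //; apply: hs.
- by move=> _ [x hx <-]; exists (x^-1)%g; rewrite ?mulmorphV //; apply: hv.
- by move=> _ _ [x hx <-] [y hy <-]; exists (x * y)%g; rewrite ?gmulfM //; apply: hm.
Qed.

Lemma amalgam_factor_subgroup b : is_subgroup (M b).
Proof. by case: b; apply: range_subgroup. Qed.

Lemma amalgam_core_sub b : H `<=` M b.
Proof.
case: b; first rewrite amalgam_coreE.
  by move=> _ [x _ <-]; exists x.
by move=> _ [x _ <-]; exists x.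
Qed.

Lemma amalgam_length_system b : length_system H (S b).
Proof.
case: b; first by rewrite amalgam_coreE; apply: length_system_image.
exact: length_system_image.
Qed.

Lemma amalgam_reached b x : M b x -> reached H (S b) x.
Proof.
case: b => -[y _ <-].
  have [n hn] := reachB y; exists n; rewrite amalgam_coreE.
  by apply/wball_image.
by have [n hn] := reachA y; exists n; apply/wball_image.
Qed.

Lemma wlen_amalgamA a : wlen H (S false) (jA a) = wlen (range iA) SA a.
Proof. exact: wlen_image. Qed.

Lemma wlen_amalgamB b : wlen H (S true) (jB b) = wlen (range iB) SB b.
Proof. by rewrite amalgam_coreE; exact: wlen_image. Qed.

Let HM := amalgam_core_sub.
Let Msub := amalgam_factor_subgroup.
Let lsS := amalgam_length_system.
Let genM := amalgam_reached.
Let lsU : length_system H U := length_system_union lsS.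

(** Multiplying on the left by a factor element changes only the first letter of
    a reduced word, adds one, or cancels one whose remainder in [H] is absorbed
    by the next letter. *)
Lemma reduced_mul b m b' w h : M b m -> reduced H M b' w -> H h ->
  exists b'' w' h', [/\ reduced H M b'' w', H h' & (m * (gprod w * h) = gprod w' * h')%g].
Proof.
move=> hm hw hh.
have ab d q k : reduced H M d q -> H k ->
  exists b'' w' h', [/\ reduced H M b'' w', H h' & (k * (gprod q * h) = gprod w' * h')%g].
  move=> hq hk; have [r _ _ [k' hk' e]] := absorbP HM Msub lsS genM hq hk.
  exists d, (absorb k q), (k' * h)%g; split=> //.
    exact: subgroupM (ls_subgroup (lsS true)) _ _.
  by rewrite mulgA e mulgA.
have [mH|mH] := pselect (H m); first exact: ab hw mH.
have [bb'|bb'] : b' = b \/ b' = ~~ b by case: (b) (b') => -[]; auto.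
  rewrite bb' in hw; case: w hw => [_|y w [hy hyH hw]].
    by exists b, [:: m], h; split=> //; rewrite /= mulg1 mul1g.
  have [myH|myH] := pselect (H (m * y)%g).
    by have := ab _ _ _ hw myH; rewrite /= !mulgA.
  exists b, ((m * y)%g :: w), h; split=> //; last by rewrite /= !mulgA.
  by split=> //; apply: subgroupM.
rewrite bb' in hw; exists b, (m :: w), h; split=> //; by rewrite /= !mulgA.
Qed.

(** The elements preserving the set of products of reduced words under left
    multiplication, together with their inverses, form a subgroup that contains
    both factors. *)
Lemma amalgam_has_reduced g :
  exists b w h, [/\ reduced H M b w, H h & g = (gprod w * h)%g].
Proof.
pose P x := exists b w h, [/\ reduced H M b w, H h & x = (gprod w * h)%g].
have PM b m x : M b m -> P x -> P (m * x)%g.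
  by move=> hm [b' [w [h [hw hh ->]]]]; apply: reduced_mul hm hw hh.
pose Q := [set m : G | forall x, P x -> P (m * x)%g /\ P (m^-1 * x)%g].
have QM b m : M b m -> Q m.
  by move=> hm x hx; split; [exact: PM hm hx|exact: PM (subgroupV (Msub b) hm) hx].
have hQ : is_subgroup Q.
  split; first by move=> x; rewrite invg1 !mul1g.
  move=> a c ha hc x hx; rewrite invgM invgK -!mulgA.
  by split; [apply: (ha _ _).1; apply: (hc _ _).2|apply: (hc _ _).1; apply: (ha _ _).2].
have Qg : Q g.
  apply: (pushout_generated glue universal hQ) => [a|b].
    by apply: (QM false); exists a.
  by apply: (QM true); exists b.
have P1 : P 1%g.
  exists true, [::], 1%g; split=> //; last by rewrite /= mulg1.
  exact: subgroup1 (ls_subgroup (lsS true)).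
by have [] := Qg 1%g P1; rewrite mulg1.
Qed.

Let wT (t : A + B) : nat :=
  match t with inl a => wlen (range iA) SA a | inr b => wlen (range iB) SB b end.
Let prA (t : A + B) : option A := if t is inl a then Some a else None.
Let prB (t : A + B) : option B := if t is inr b then Some b else None.
Let actA := factor_act iA inl prA.
Let actB := factor_act iB inr prB.
Let free (b : bool) : seq (A + B) -> bool := if b then unled iB prB else unled iA prA.

Let wA1 : wlen (range iA) SA 1%g = 0.
Proof. by apply: wlenH; exact: subgroup1 (ls_subgroup lsA). Qed.
Let wB1 : wlen (range iB) SB 1%g = 0.
Proof. by apply: wlenH; exact: subgroup1 (ls_subgroup lsB). Qed.
Let wAl c x : wlen (range iA) SA (iA c * x)%g = wlen (range iA) SA x.
Proof. by apply: (wlenHl lsA) => //; exists c. Qed.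
Let wBl c x : wlen (range iB) SB (iB c * x)%g = wlen (range iB) SB x.
Proof. by apply: (wlenHl lsB) => //; exists c. Qed.
Let wAr c x : wlen (range iA) SA (x * iA c)%g = wlen (range iA) SA x.
Proof. by apply: (wlenHr lsA) => //; exists c. Qed.
Let wBr c x : wlen (range iB) SB (x * iB c)%g = wlen (range iB) SB x.
Proof. by apply: (wlenHr lsB) => //; exists c. Qed.
Let wTA a : wT (inl a) = wlen (range iA) SA a. Proof. by []. Qed.
Let wTB b : wT (inr b) = wlen (range iB) SB b. Proof. by []. Qed.
Let prAK : pcancel inl prA. Proof. by []. Qed.
Let prBK : pcancel inr prB. Proof. by []. Qed.
Let prAKV t a : prA t = Some a -> t = inl a. Proof. by case: t => //= ? [->]. Qed.
Let prBKV t b : prB t = Some b -> t = inr b. Proof. by case: t => //= ? [->]. Qed.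

(** The normal form of a reduced word has one letter per letter of the word; the
    second claim, that it has no leading letter of the opposite type, is what
    allows the next letter to be added. *)
Lemma reduced_state (h : {multiplicative G -> bijection (C * seq (A + B))%type}) :
  (forall a o, bfun (h (jA a)) o = actA a o) ->
  (forall b o, bfun (h (jB b)) o = actB b o) ->
  forall b w, reduced H M b w -> let o := bfun (h (gprod w)) (1%g, [::]) in
    tally wT o.2 = weight H S b w /\ free (~~ b) o.2.
Proof.
move=> hA hB b w; elim: w b => [|x w IH] b /=.
  by move=> _; rewrite mulmorph1; case: b.
move=> [hx hxH /IH []]; rewrite negbK gmulfM /=.
set o := bfun _ (1%g, [::]) => <-.
case: b hx => -[y _ e]; rewrite -{x}e in hxH * => fo.
  have yH : ~ range iB y by move=> hy; apply: hxH; rewrite amalgam_coreE; exists y.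
  rewrite hB wlen_amalgamB.
  by have [z [ez ->]] := factor_act_unled wTB wB1 wBl wBr fo yH; rewrite /actB ez.
have yH : ~ range iA y by move=> hy; apply: hxH; exists y.
rewrite hA wlen_amalgamA.
by have [z [ez ->]] := factor_act_unled wTA wA1 wAl wAr fo yH; rewrite /actA ez.
Qed.

(** Each element of the generating set changes one letter in one factor, and
    the length of that letter by at most one. *)
Lemma tally_step (h : {multiplicative G -> bijection (C * seq (A + B))%type}) :
  (forall a o, bfun (h (jA a)) o = actA a o) ->
  (forall b o, bfun (h (jB b)) o = actB b o) ->
  forall n x o, wball H U n x -> tally wT (bfun (h x) o).2 <= n + tally wT o.2.
Proof.
move=> hA hB; elim=> [|n IH] x o.
  move=> [_ [c _ <-] <-]; rewrite hA /actA.
  by rewrite (factor_act_range iA_inj prAKV).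
move=> [y [s [hy hs ->]]]; rewrite gmulfM /=.
apply: leq_trans (IH _ _ hy) _; rewrite addSnnS leq_add2l -add1n.
case: hs => -[t ht <-].
  rewrite hA /actA (tally_factor_act prA wTA wA1 wAl).
  rewrite (tally_lead iA prAKV wTA wA1 o.2) addnA leq_add2r -mulgA.
  apply: leq_trans (wlenM lsA (reachA _) (reachA _)) _; rewrite wAl leq_add2r.
  by apply: wlen_le; rewrite wball1.
rewrite hB /actB (tally_factor_act prB wTB wB1 wBl).
rewrite (tally_lead iB prBKV wTB wB1 o.2) addnA leq_add2r -mulgA.
apply: leq_trans (wlenM lsB (reachB _) (reachB _)) _; rewrite wBl leq_add2r.
by apply: wlen_le; rewrite wball1.
Qed.

(** The upper bound is the triangle inequality.  For the lower bound, let [G] act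
    on normal forms: the empty one is sent by the word to one whose weight is
    that of the word, while each generator adds at most one. *)
Lemma amalgam_wlen_reduced b w : reduced H M b w ->
  wlen H U (gprod w) = weight H S b w.
Proof.
move=> hw.
have [fA fAE] := action_morphism (factor_act1 iA_inj prAKV) (factor_actM iA prAK).
have [fB fBE] := action_morphism (factor_act1 iB_inj prBKV) (factor_actM iB prBK).
have [c|h [hA hB _]] := universal (f := fA) (g := fB).
  apply: bijectionP => o; rewrite fAE fBE.
  by rewrite (factor_act_range iA_inj prAKV) (factor_act_range iB_inj prBKV).
have hA' a o : bfun (h (jA a)) o = actA a o by rewrite hA fAE.
have hB' b' o : bfun (h (jB b')) o = actB b' o by rewrite hB fBE.
have hb : wball H U (weight H S b w) (gprod w).
  elim: w b hw => [|x w IH] b /=; first by move=> _; exact: subgroup1 (ls_subgroup lsU).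
  move=> [hx _ /IH hw]; apply: (wball_mul lsU) hw.
  have := wball_wlen (genM hx); move: (wlen _ _ x) => n.
  elim: n x {hx} => [//|n IHn] x [y [s [/IHn hy hs ->]]]; exists y, s; split=> //.
  by case: b {IHn} hs {hy} => hs; [right|left].
apply/eqP; rewrite eqn_leq (wlen_le hb) /=.
have [<- _] := reduced_state hA' hB' hw.
rewrite -[X in _ <= X]addn0; apply: (tally_step hA' hB' (1%g, [::])).
by apply: wball_wlen; exists (weight H S b w).
Qed.

End ReducedWords.

(** * The geometric realization of a graph *)

Section Realization.
Import Order.TTheory GRing.Theory Num.Theory.
Local Open Scope ring_scope.
Variables (R : realType) (V : choiceType) (e : rel V) (D : V -> V -> nat).
Hypothesis esym : symmetric e.
Hypothesis D0 : forall u, D u u = 0%N.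
Hypothesis Dedge : forall u v b, e u v -> (D u b <= (D v b).+1)%N.
Hypothesis Dpath : forall u v,
  exists p, [/\ path e u p, last u p = v & size p = D u v].

Local Notation edge_point := (@edge_point R V).
Local Notation pl_path := (@pl_path R V e).
Local Notation vertex u := (edge_point u u 0).
Local Notation rdist := (@realization_dist R V e).

Lemma edge_point0 u v : edge_point u v 0 = vertex u.
Proof. by apply/funext => w; rewrite /Defs.edge_point !mul0rn. Qed.

Lemma edge_point1 u v : edge_point u v 1 = vertex v.
Proof. by apply/funext => w; rewrite /Defs.edge_point subrr subr0 !mul0rn add0r addr0. Qed.

Lemma realization_vertex u : realization e (vertex u).
Proof. by left; exists u. Qed.

Lemma pl_path_ge0 x y l : pl_path x y l -> 0 <= l.
Proof. by elim=> // u v s t y' l' _ _ _ _ h; rewrite addr_ge0. Qed.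

Lemma pl_path_cat x y z l m : pl_path x y l -> pl_path y z m -> pl_path x z (l + m).
Proof.
elim=> [x' _|u v s t y' l' huv hs ht _ IH] h; first by rewrite add0r.
by rewrite -addrA; apply: pl_path_cons => //; apply: IH.
Qed.

Lemma pl_path_of_path p u : path e u p ->
  pl_path (vertex u) (vertex (last u p)) (size p)%:R.
Proof.
elim: p u => [|v p IH] u /=; first by move=> _; apply/pl_path_nil/realization_vertex.
move=> /andP[huv hp]; have -> : (size p).+1%:R = `|0 - 1| + (size p)%:R :> R.
  by rewrite sub0r normrN normr1 -natr1 addrC.
rewrite -(edge_point0 u v); apply: pl_path_cons => //; rewrite ?lexx ?ler01 //.
by rewrite edge_point1; apply: IH.
Qed.

(** The distance to the vertex [b], extended linearly over the edges.  It is
    1-Lipschitz along edges, which bounds the length of paths from below however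
    finely they are subdivided. *)
Definition interpolate b u v (t : R) : R := (1 - t) * (D u b)%:R + t * (D v b)%:R.

Lemma edge_point_sum (f : V -> R) (s : seq V) u v t : uniq s -> u \in s -> v \in s ->
  \sum_(w <- s) edge_point u v t w * f w = (1 - t) * f u + t * f v.
Proof.
move=> us hu hv.
have one a k : a \in s -> \sum_(w <- s) k *+ (w == a) * f w = k * f a.
  move=> ha; rewrite (bigD1_seq a) //= eqxx big1 ?addr0 // => w /negbTE ->.
  by rewrite mul0r.
rewrite -(one u) // -(one v) // -big_split /=; apply: eq_bigr => w _.
by rewrite -mulrDl.
Qed.

(** A point may be given by several edges; the value is the sum of the
    distances of the vertices to [b], weighted by its barycentric coordinates. *)
Lemma interpolate_eq b u v t u' v' t' :
  edge_point u v t = edge_point u' v' t' ->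
  interpolate b u v t = interpolate b u' v' t'.
Proof.
move=> h; pose s := undup [:: u; v; u'; v'].
rewrite /interpolate -(@edge_point_sum (fun w => (D w b)%:R) s) ?undup_uniq //.
- rewrite h edge_point_sum ?undup_uniq // mem_undup !inE eqxx ?orbT //.
- by rewrite mem_undup !inE eqxx.
- by rewrite mem_undup !inE eqxx orbT.
Qed.

Lemma interpolate_le_pl_path x y l : pl_path x y l ->
  forall b u v s, y = vertex b -> x = edge_point u v s -> interpolate b u v s <= l.
Proof.
elim=> [x' _|u v s t y' l' huv hs ht _ IH] b u' v' s' hy hx.
  rewrite (@interpolate_eq b u' v' s' b b 0) -?hx //.
  by rewrite /interpolate !D0 !mulr0 addr0.
rewrite -(interpolate_eq b hx).
have := IH b u v t hy erefl; rewrite /interpolate.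
have h1 : (D u b)%:R <= (D v b)%:R + 1 :> R by rewrite natr1 ler_nat; apply: Dedge.
have h2 : (D v b)%:R <= (D u b)%:R + 1 :> R.
  by rewrite natr1 ler_nat; apply: Dedge; rewrite esym.
move: ((D u b)%:R : R) ((D v b)%:R : R) h1 h2 => du dv h1 h2 h.
have := ler_norm (s - t); have := ler_norm (t - s); rewrite (distrC t s).
by move: (`|s - t|) => n; nra.
Qed.

Definition close_to (x : V -> R) a : Prop := exists2 l, l <= 1 &
  pl_path x (vertex a) l /\ pl_path (vertex a) x l.

Lemma close_vertex a : close_to (vertex a) a.
Proof. by exists 0; rewrite ?ler01 //; split; apply/pl_path_nil/realization_vertex. Qed.

Lemma realization_close x : realization e x -> exists a, close_to x a.
Proof.
move=> hx; case: (hx) => [[u ->]|[u [v [t [huv ht xE]]]]].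
  by exists u; apply: close_vertex.
have h01 : ((0 : R) <= (0 : R) <= (1 : R)) by rewrite lexx ler01.
exists u; exists t; first by case/andP: ht.
have nt : `|t - 0| + 0 = t by rewrite addr0 subr0 ger0_norm //; case/andP: ht.
split.
  rewrite -[X in pl_path _ _ X]nt xE; apply: pl_path_cons => //; rewrite edge_point0.
  exact/pl_path_nil/realization_vertex.
rewrite -[X in pl_path _ _ X]nt distrC -(edge_point0 u v); apply: pl_path_cons (h01) ht _ => //.
by rewrite -xE; apply: pl_path_nil.
Qed.

(** Only a coarse comparison is needed: errors bounded independently of the
    points are absorbed by the hyperbolicity constant. *)
Lemma rdist_close x y a b : close_to x a -> close_to y b ->
  (D a b)%:R - 2 <= rdist x y <= (D a b)%:R + 2.
Proof.
move=> [l hl [xa ax]] [m hm [yb yb']].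
have [p [hp1 hp2 hp3]] := Dpath a b.
have xy : pl_path x y (l + (D a b)%:R + m).
  have := pl_path_of_path hp1; rewrite hp2 hp3 => h.
  exact: pl_path_cat (pl_path_cat xa h) yb'.
apply/andP; split.
  apply: lb_le_inf; first by exists (l + (D a b)%:R + m).
  move=> k /= hk.
  have := pl_path_cat (pl_path_cat ax hk) yb.
  move=> /interpolate_le_pl_path /(_ b a a 0 erefl erefl).
  by rewrite /interpolate; lra.
apply: (@le_trans _ _ (l + (D a b)%:R + m)); last by lra.
by apply: ge_inf => //; exists 0 => k /= /pl_path_ge0.
Qed.

Lemma hyperbolic_graphP : hyperbolic_graph R e <-> hyperbolic_pmetric D.
Proof.
split=> [[delta h]|[delta h]].
  (* Either alternative of the minimum involves four distances, each with an error
     of at most 2. *)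
  exists (Num.bound `|2 * delta + 8|) => x y z w.
  have hd : 2 * delta + 8 <= (Num.bound `|2 * delta + 8|)%:R :> R.
    by apply: le_trans (ler_norm _) _; apply/ltW/archi_boundP.
  have := h _ _ _ _ (realization_vertex x) (realization_vertex y)
    (realization_vertex z) (realization_vertex w).
  move: (Num.bound _) hd => n hd.
  have c u v := rdist_close (close_vertex u) (close_vertex v).
  have /andP[? ?] := c x w; have /andP[? ?] := c z w; have /andP[? ?] := c x z.
  have /andP[? ?] := c y w; have /andP[? ?] := c x y; have /andP[? ?] := c y z.
  rewrite lerBlDr ge_min /gromov_product addn_maxl leq_max -!(ler_nat R) !natrD.
  by case/orP=> hh; apply/orP; [left|right]; lra.
exists (delta%:R + 8) => x y z w.
move=> /realization_close[x' hx] /realization_close[y' hy].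
move=> /realization_close[z' hz] /realization_close[w' hw].
have /andP[? ?] := rdist_close hx hw; have /andP[? ?] := rdist_close hz hw.
have /andP[? ?] := rdist_close hx hz; have /andP[? ?] := rdist_close hy hw.
have /andP[? ?] := rdist_close hx hy; have /andP[? ?] := rdist_close hy hz.
have := h x' y' z' w'; rewrite addn_maxl leq_max -!(ler_nat R) !natrD.
have d0 : 0 <= delta%:R :> R by [].
rewrite lerBlDr ge_min /gromov_product.
by case/orP => ?; apply/orP; [left|right]; lra.
Qed.

End Realization.

(** * Cayley-Abels graphs as word metrics *)

Section TopologicalGroups.
Variable T : topGroupType.
Implicit Types (H S K : set T).

Lemma continuous_mulg2 (X : topologicalType) (f g : X -> T) :
  continuous f -> continuous g -> continuous (fun x => (f x * g x)%g).
Proof.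
move=> cf cg x; apply: (@continuous_comp _ _ _ (fun x => (f x, g x))
  (fun p : T * T => (p.1 * p.2)%g)); last exact: mulg_continuous.
by apply: cvg_pair => /=; [exact: cf|exact: cg].
Qed.

Lemma continuous_cst_fun (X Y : topologicalType) (y : Y) :
  continuous (fun _ : X => y).
Proof. by move=> x; apply: cvg_cst. Qed.

Lemma continuous_id_fun (X : topologicalType) : continuous (fun x : X => x).
Proof. by move=> x; apply: cvg_id. Qed.

Lemma continuous_mull a : continuous (fun x : T => (a * x)%g).
Proof. by apply: continuous_mulg2; [exact: continuous_cst_fun|exact: continuous_id_fun]. Qed.

Lemma continuous_mulr a : continuous (fun x : T => (x * a)%g).
Proof. by apply: continuous_mulg2; [exact: continuous_id_fun|exact: continuous_cst_fun]. Qed.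

Lemma open_preimage (X Y : topologicalType) (f : X -> Y) (O : set Y) :
  continuous f -> open O -> open [set x | O (f x)].
Proof. by move=> cf oO; move/continuousP: cf; apply. Qed.

Lemma image_compact (X Y : topologicalType) (f : X -> Y) (K : set X) :
  continuous f -> compact K -> compact (f @` K).
Proof. by move=> cf; apply: continuous_compact; apply: continuous_subspaceT. Qed.

Lemma open_lcoset H x : open H -> open [set y | H (x^-1 * y)%g].
Proof. by move=> oH; apply: open_preimage oH; apply: continuous_mull. Qed.

Lemma nbhs_lcoset H x : is_subgroup H -> open H -> nbhs x [set y | H (x^-1 * y)%g].
Proof.
move=> hH oH; apply: open_nbhs_nbhs; split; first exact: open_lcoset.
by rewrite /= mulVg; apply: subgroup1.
Qed.

Lemma open_subgroup_closed H : is_subgroup H -> open H -> closed H.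
Proof.
move=> hH oH; rewrite -[H]setCK; apply: open_closedC.
have -> : ~` H = \bigcup_(x in ~` H) [set y | H (x^-1 * y)%g].
  apply/seteqP; split=> x; first by move=> hx; exists x => //=; rewrite mulVg; apply: subgroup1.
  move=> [y /= hy hyx] hx; apply: hy; rewrite -[y]invgK; apply: subgroupV => //.
  by rewrite -[(y^-1)%g](mulgK x); apply: subgroupM => //; apply: subgroupV.
by apply: bigcup_open => x _; apply: open_lcoset.
Qed.

Lemma compact_lcoset K a : compact K -> compact [set x | K (a^-1 * x)%g].
Proof.
move=> cK; have -> : [set x | K (a^-1 * x)%g] = (fun x => (a * x)%g) @` K.
  apply/seteqP; split=> x /=; first by move=> hx; exists (a^-1 * x)%g; rewrite ?mulVKg.
  by move=> [y hy <-]; rewrite mulKg.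
by apply: image_compact => //; apply: continuous_mull.
Qed.

Lemma compact_setM K S : compact K -> compact S ->
  compact [set z | exists x y, [/\ K x, S y & z = (x * y)%g]].
Proof.
move=> cK cS.
have -> : [set z | exists x y, [/\ K x, S y & z = (x * y)%g]] =
    (fun p : T * T => (p.1 * p.2)%g) @` (K `*` S).
  apply/seteqP; split=> z /=.
    by move=> [x [y [hx hy ->]]]; exists (x, y).
  by move=> [[x y] [hx hy] <-]; exists x, y.
by apply: image_compact; [exact: mulg_continuous|exact: compact_setX].
Qed.

Lemma compact_setV K : compact K -> compact [set z | K (z^-1)%g].
Proof.
move=> cK; have -> : [set z | K (z^-1)%g] = (fun x => (x^-1)%g) @` K.
  apply/seteqP; split=> x /=; first by move=> hx; exists (x^-1)%g; rewrite ?invgK.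
  by move=> [y hy <-]; rewrite invgK.
by apply: image_compact => //; exact: invg_continuous.
Qed.

(** A function constant on the cosets of an open subgroup is locally constant. *)
Lemma compact_finite_image (V : choiceType) (f : T -> V) H K :
  is_subgroup H -> open H -> compact K ->
  (forall x h, H h -> f (x * h)%g = f x) -> finite_set (f @` K).
Proof.
move=> hH oH cK fH.
(* The characterization of compactness by covers is stated for pointed spaces. *)
pose TP : ptopologicalType := HB.pack (Topological.sort T) (isPointed.Build (Topological.sort T) 1%g).
have cK' : @cover_compact TP K by rewrite -compact_cover.
have fE x y : H (x^-1 * y)%g -> f y = f x.
  by move=> h; rewrite -(fH x _ h) mulVKg.
have [v _||D _ KD] := cK' V setT (fun v => [set x : T | f x = v]).
- rewrite openE => x /= <-; apply: filterS (nbhs_lcoset x hH oH) => y /=.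
  exact: fE.
- by move=> x _; exists (f x).
apply: (@sub_finite_set _ _ [set` D]); last by apply/finite_fsetP; exists D.
by move=> _ [x /KD[v hv /= fx] <-]; rewrite fx.
Qed.

Record word_structure H S : Prop := {
  ws_length : length_system H S ;
  ws_open : open H ;
  ws_compact : compact S ;
  ws_reached : forall g, reached H S g
}.

(** The length for one structure is locally constant, so it takes finitely many
    values on the compact generating set of the other. *)
Lemma word_structure_bounded H S H' S' : word_structure H S -> word_structure H' S' ->
  exists L, S' `<=` wball H S L.
Proof.
move=> hS hS'; have ls := ws_length hS; have hH := ls_subgroup ls.
have fin : finite_set (wlen H S @` S').
  apply: (compact_finite_image hH (ws_open hS) (ws_compact hS')) => x h hh.
  by apply: (wlenHr ls) => //; apply: (ws_reached hS).
have /finite_seqP[s sE] := fin.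
exists (\max_(n <- s) n) => g hg.
apply: (wball_mono ls _ (wball_wlen (ws_reached hS g))).
apply: (@leq_bigmax_seq _ s xpredT id) => //.
have : (wlen H S @` S') (wlen H S g) by exists g.
by rewrite sE.
Qed.

Lemma wdist_compare H S H' S' : word_structure H S -> word_structure H' S' ->
  exists L, forall x y, wdist H S x y <= L * (wdist H' S' x y).+1.
Proof.
move=> hS hS'; have [L hL] := word_structure_bounded hS hS'.
exists L => x y; apply: wlen_le.
have := wball_wlen (ws_reached hS' (x^-1 * y)%g).
rewrite -/(wdist H' S' x y); move: (wdist _ _ _ _) (x^-1 * y)%g => n.
elim: n => [|n IH] g.
  by move=> hg; rewrite muln1; apply: hL; apply: (ls_sub (ws_length hS')).
move=> [a [s [ha hs ->]]]; rewrite mulnS addnC.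
by apply: (wball_mul (ws_length hS)); [exact: IH|exact: hL].
Qed.

Lemma hyperbolic_word_structure H S H' S' :
  word_structure H S -> word_structure H' S' ->
  hyperbolic_pmetric (wdist H S) -> hyperbolic_pmetric (wdist H' S').
Proof.
move=> hS hS'; have [L hL] := wdist_compare hS hS'; have [L' hL'] := wdist_compare hS' hS.
apply: (@hyperbolic_quasi_isometry _ _ _ (L + L')).
- exact: wdist_pmetric (ws_length hS) (ws_reached hS).
- exact: wdist_pmetric (ws_length hS') (ws_reached hS').
- by move=> x y; apply: leq_trans (hL x y) _; rewrite leq_mul2r leq_addr orbT.
- by move=> x y; apply: leq_trans (hL' x y) _; rewrite leq_mul2r leq_addl orbT.
Qed.

Section CayleyAbels.
Variables (V : choiceType) (e : rel V) (act : T -> V -> V) (v0 : V).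

Definition ca_stab : set T := [set g | act g v0 = v0].
Definition ca_steps : set T := [set g | act g v0 = v0 \/ e v0 (act g v0)].

Hypothesis ca : cayley_abels_graph e act.
Hypothesis v0P : forall v, exists g, act g v0 = v.

Let actK g v : act g^-1%g (act g v) = v.
Proof. by rewrite -(ca_actM ca) mulVg (ca_act1 ca). Qed.

Lemma ca_length_system : length_system ca_stab ca_steps.
Proof.
split.
- split; first exact: ca_act1 ca v0.
  by move=> x y hx hy; rewrite /ca_stab /= (ca_actM ca) -{1}hy actK.
- by move=> h; left.
- move=> x [hx|hx]; first by left; rewrite -{1}hx actK.
  by right; rewrite (ca_sym ca) -(ca_act_edge ca x) -(ca_actM ca) mulgV (ca_act1 ca).
- move=> x h hx hh; rewrite /ca_steps /= (ca_actM ca) hh; exact: hx.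
Qed.

Let ls := ca_length_system.

Lemma ca_steps_compact : compact ca_steps.
Proof.
have -> : ca_steps = ca_stab `|` \bigcup_(w in [set w | e v0 w]) [set g | act g v0 = w].
  apply/seteqP; split=> g [h|h]; [by left| |by left|].
    by right; exists (act g v0).
  by case: h => w hw /= gw; right; rewrite gw.
have /finite_seqP[s ->] := ca_locally_finite ca v0.
rewrite bigcup_seq; apply: compactU; first exact: (ca_stab_compact ca).
apply: bigsetU_compact => w _; have [k <-] := v0P w.
have -> : [set g | act g v0 = act k v0] = [set g | ca_stab (k^-1 * g)%g].
  apply/seteqP; split=> g; rewrite /ca_stab /= (ca_actM ca) => h.
    by rewrite h actK.
  by rewrite -{2}h -(ca_actM ca) mulgV (ca_act1 ca).
exact: (@compact_lcoset ca_stab k (@ca_stab_compact _ _ _ _ ca v0)).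
Qed.

Lemma ca_steps_edge x y : e (act x v0) (act y v0) -> ca_steps (x^-1 * y)%g.
Proof. by move=> h; right; rewrite (ca_actM ca) -(ca_act_edge ca x) -(ca_actM ca) mulgV (ca_act1 ca). Qed.

Lemma wball_of_path p x y : path e (act x v0) p -> last (act x v0) p = act y v0 ->
  wball ca_stab ca_steps (size p) (x^-1 * y)%g.
Proof.
elim: p x => [|w p IH] x /=.
  by move=> _ h; rewrite /ca_stab /= (ca_actM ca) -h actK.
move=> /andP[hxw hp] hl; have [z zw] := v0P w; rewrite -zw in hxw hp hl.
have -> : (x^-1 * y = (x^-1 * z) * (z^-1 * y))%g by rewrite mulgA mulgK.
apply: (@wball_mul _ _ _ ls 1 (size p)); last exact: IH.
by rewrite wball1 //; apply: ca_steps_edge.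
Qed.

Lemma path_of_wball n x g : wball ca_stab ca_steps n g ->
  exists p, [/\ path e (act x v0) p, last (act x v0) p = act (x * g)%g v0 & size p <= n].
Proof.
elim: n g => [|n IH] g; first by move=> hg; exists [::]; rewrite (ca_actM ca) hg.
move=> [y [s [/IH[p [h1 h2 h3]] [hs|hs] ->]]].
  by exists p; rewrite mulgA (ca_actM ca) hs; split=> //; apply: leqW.
exists (rcons p (act (x * (y * s))%g v0)); rewrite rcons_path last_rcons size_rcons.
by rewrite h1 h2 mulgA (ca_actM ca (x * y)%g) (ca_act_edge ca).
Qed.

Lemma ca_reached g : reached ca_stab ca_steps g.
Proof.
have [p hp hl] := ca_connected ca (act 1%g v0) (act g v0).
by exists (size p); have := wball_of_path hp hl; rewrite invg1 mul1g.
Qed.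

Lemma ca_word_structure : word_structure ca_stab ca_steps.
Proof.
split; [exact: ls|exact: ca_stab_open ca v0|exact: ca_steps_compact|exact: ca_reached].
Qed.

(** Choosing an element that carries [v0] to each vertex identifies distances
    between vertices with [wdist]; other choices differ by the stabilizer, which
    does not change lengths. *)
Lemma hyperbolic_graph_wdist (R : realType) :
  hyperbolic_graph R e <-> hyperbolic_pmetric (wdist ca_stab ca_steps).
Proof.
pose sec v := projT1 (cid (v0P v)).
have secE v : act (sec v) v0 = v by exact: (projT2 (cid (v0P v))).
pose d := wdist ca_stab ca_steps; pose D u v := d (sec u) (sec v).
have [dxx dC dT dM] := wdist_pmetric ls ca_reached.
have PE : hyperbolic_graph R e <-> hyperbolic_pmetric D.
  apply: hyperbolic_graphP; first exact: (ca_sym ca).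
  - by move=> u; apply: dxx.
  - move=> u v b huv; rewrite -add1n; apply: leq_trans (dT _ (sec v) _) _.
    rewrite leq_add2r; apply: wlen_le; rewrite wball1 //.
    by apply: ca_steps_edge; rewrite !secE.
  - move=> u v; have [p [h1 h2 h3]] := path_of_wball (sec u) (wball_wlen (ca_reached ((sec u)^-1 * sec v)%g)).
    rewrite mulVKg !secE in h1 h2; exists p; split=> //.
    apply/eqP; rewrite eqn_leq; apply/andP; split; first exact: h3.
    by apply: wlen_le; apply: wball_of_path; rewrite !secE.
have dE g h : d g h = D (act g v0) (act h v0).
  have sg k : exists2 x, ca_stab x & sec (act k v0) = (k * x)%g.
    exists (k^-1 * sec (act k v0))%g; last by rewrite mulVKg.
    by rewrite /ca_stab /= (ca_actM ca) secE actK.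
  rewrite /D; have [x hx ->] := sg g; have [y hy ->] := sg h.
  by rewrite /d (wdist_mulHr ls _ _ ca_reached).
rewrite PE; split=> -[delta h]; exists delta => x y z w.
  by rewrite -/d !dE; apply: h.
exact: h.
Qed.

End CayleyAbels.

Section CosetGraph.
Variables (H S : set T) (hS : word_structure H S).
Let ls := ws_length hS.
Let hH := ls_subgroup ls.

(** The vertices of the graph are cosets of [H], represented by the elements
    that [lrep] chooses in them. *)
Definition lrep (x : T) : T := xget 1%g [set y | H (x^-1 * y)%g].

Lemma lrepP x : H (x^-1 * lrep x)%g.
Proof.
apply: (@xgetPex _ _ [set y | H (x^-1 * y)%g]); exists x => /=.
by rewrite mulVg; apply: subgroup1.
Qed.

Lemma lrep_eq x y : lrep x = lrep y <-> H (x^-1 * y)%g.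
Proof.
split=> [h|h].
  have -> : (x^-1 * y = (x^-1 * lrep x) * (y^-1 * lrep y)^-1)%g.
    by rewrite h invgM invgK mulgA mulgK.
  by apply: subgroupM (lrepP x) _ => //; apply: subgroupV (lrepP y).
rewrite /lrep; have -> // : [set z | H (x^-1 * z)%g] = [set z | H (y^-1 * z)%g].
apply/seteqP; split=> z /= hz.
  have -> : (y^-1 * z = (x^-1 * y)^-1 * (x^-1 * z))%g by rewrite invgM invgK mulgA mulgK.
  by apply: subgroupM => //; apply: subgroupV.
have -> : (x^-1 * z = (x^-1 * y) * (y^-1 * z))%g by rewrite mulgA mulgK.
exact: subgroupM.
Qed.

Lemma lrepK x : lrep (lrep x) = lrep x.
Proof. by apply/esym/lrep_eq/lrepP. Qed.

Definition coset_vertex : choiceType := {x : T | lrep x == x}.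

Definition mkvertex x : coset_vertex := exist _ (lrep x) (introT eqP (lrepK x)).

Lemma mkvertexP x y : mkvertex x = mkvertex y <-> H (x^-1 * y)%g.
Proof.
rewrite -lrep_eq; split; first by move=> /(congr1 val).
by move=> h; apply: val_inj.
Qed.

Lemma mkvertex_val (v : coset_vertex) : mkvertex (val v) = v.
Proof. by apply: val_inj; apply/eqP; exact: (valP v). Qed.

Definition coset_edge : rel coset_vertex :=
  fun u v => (u != v) && `[< S ((val u)^-1 * val v)%g >].

Definition coset_act g (v : coset_vertex) : coset_vertex := mkvertex (g * val v)%g.

Lemma coset_actE g x : coset_act g (mkvertex x) = mkvertex (g * x)%g.
Proof.
apply/mkvertexP; rewrite /= invgM -mulgA mulKg.
rewrite -[(_ * x)%g]invgK invgM invgK; apply: subgroupV => //; exact: lrepP.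
Qed.

Lemma coset_edgeE x y : coset_edge (mkvertex x) (mkvertex y) <->
  S (x^-1 * y)%g /\ ~ H (x^-1 * y)%g.
Proof.
have E : S ((lrep x)^-1 * lrep y)%g <-> S (x^-1 * y)%g.
  have aux a b a' b' : H (a^-1 * a')%g -> H (b^-1 * b')%g -> S (a^-1 * b)%g ->
      S (a'^-1 * b')%g.
    move=> ha hb hab.
    have -> : (a'^-1 * b' = (a^-1 * a')^-1 * ((a^-1 * b) * (b^-1 * b')))%g.
      by rewrite invgM invgK !mulgA !mulgK.
    by apply: (ls_mull ls); [exact: subgroupV|exact: (ls_mulr ls)].
  have sw a : H ((lrep a)^-1 * a)%g.
    by rewrite -[a in (_ * a)%g]invgK -invgM; apply: subgroupV => //; exact: lrepP.
  by split; apply: aux; rewrite ?sw //; apply: lrepP.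
rewrite /coset_edge /=; split.
  move=> /andP[/eqP ne /asboolP h]; split; first exact/E.
  by move=> /mkvertexP.
move=> [hs hn]; apply/andP; split; last exact/asboolP/E.
by apply/eqP => /mkvertexP.
Qed.

Lemma coset_vertexP (P : coset_vertex -> Prop) :
  (forall x, P (mkvertex x)) -> forall v, P v.
Proof. by move=> h v; rewrite -(mkvertex_val v). Qed.

Lemma Hswap x y : H (x^-1 * y)%g -> H (y^-1 * x)%g.
Proof. by move=> h; rewrite -[x in (_ * x)%g]invgK -invgM; apply: subgroupV. Qed.

Lemma coset_stab x : [set g | coset_act g (mkvertex x) = mkvertex x] =
  [set g | H (x^-1 * (g * x))%g].
Proof.
apply/seteqP; split=> g /=; rewrite coset_actE.
  by move=> /mkvertexP; apply: Hswap.
by move=> h; apply/mkvertexP; apply: Hswap.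
Qed.

Lemma coset_path n x g : wball H S n g ->
  exists2 p, path coset_edge (mkvertex x) p & last (mkvertex x) p = mkvertex (x * g)%g.
Proof.
elim: n g => [|n IH] g.
  by move=> hg; exists [::] => //=; apply/mkvertexP; rewrite mulKg.
move=> [y [s [/IH[p h1 h2] hs ->]]].
have [hsH|hsH] := pselect (H s).
  by exists p => //; rewrite h2; apply/mkvertexP; rewrite (mulgA x) mulKg.
exists (rcons p (mkvertex (x * (y * s))%g)); last by rewrite last_rcons.
by rewrite rcons_path h1 h2; apply/coset_edgeE; rewrite (mulgA x) mulKg.
Qed.

Lemma compact_word_subgroup : compact H.
Proof.
apply: (subclosed_compact _ (ws_compact hS)); last exact: ls_sub ls.
exact: open_subgroup_closed (ws_open hS).
Qed.

Lemma coset_graph : cayley_abels_graph coset_edge coset_act.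
Proof.
split.
- apply: coset_vertexP => x; apply: coset_vertexP => y.
  apply/idP/idP => /coset_edgeE[h1 h2]; apply/coset_edgeE.
    split; last by move=> /Hswap.
    by rewrite -[x in (_ * x)%g]invgK -invgM; apply: (ls_inv ls).
  split; last by move=> /Hswap.
  by rewrite -[y in (_ * y)%g]invgK -invgM; apply: (ls_inv ls).
- by move=> v; rewrite /coset_edge eqxx.
- apply: coset_vertexP => x; apply: coset_vertexP => y.
  have [n hn] := ws_reached hS (x^-1 * y)%g.
  by have [p h1 h2] := coset_path x hn; exists p => //; rewrite h2 mulVKg.
- apply: coset_vertexP => x.
  apply: (@sub_finite_set _ _ ((fun s => mkvertex (x * s)%g) @` S)).
    apply: coset_vertexP => y /coset_edgeE[hs _].
    by exists (x^-1 * y)%g => //; rewrite mulVKg.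
  apply: (compact_finite_image hH (ws_open hS) (ws_compact hS)) => s h hh.
  by apply/mkvertexP; apply: Hswap; rewrite (mulgA x) mulKg.
- by apply: coset_vertexP => x; rewrite coset_actE mul1g.
- by move=> g h; apply: coset_vertexP => x; rewrite !coset_actE mulgA.
- move=> g; apply: coset_vertexP => x; apply: coset_vertexP => y.
  rewrite !coset_actE.
  have E : ((g * x)^-1 * (g * y) = x^-1 * y)%g by rewrite invgM -mulgA mulKg.
  by apply/idP/idP => /coset_edgeE; rewrite ?E => h; apply/coset_edgeE; rewrite ?E.
- exists (mkvertex 1%g); apply: coset_vertexP => x.
  by exists x; rewrite coset_actE mulg1.
- apply: coset_vertexP => x; rewrite coset_stab.
  have -> : [set g | H (x^-1 * (g * x))%g] = [set g | [set h | H (h * x)%g] (x^-1 * g)%g].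
    by apply/seteqP; split=> g /=; rewrite mulgA.
  apply: compact_lcoset.
  have -> : [set h | H (h * x)%g] = (fun h => (h * x^-1)%g) @` H.
    apply/seteqP; split=> h /=; first by move=> hh; exists (h * x)%g; rewrite ?mulgK.
    by move=> [k hk <-]; rewrite mulgVK.
  by apply: image_compact; [exact: continuous_mulr|exact: compact_word_subgroup].
- apply: coset_vertexP => x; rewrite coset_stab.
  apply: (@open_preimage _ _ (fun g => x^-1 * (g * x))%g); last exact: ws_open hS.
  by apply: continuous_mulg2; [exact: continuous_cst_fun|exact: continuous_mulr].
Qed.

Lemma coset_stab1 : ca_stab coset_act (mkvertex 1%g) = H.
Proof. by rewrite /ca_stab coset_stab; apply/seteqP; split=> g /=; rewrite invg1 mul1g mulg1. Qed.

Lemma coset_steps1 : ca_steps coset_edge coset_act (mkvertex 1%g) = S.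
Proof.
apply/seteqP; split=> g.
  move=> []; first by move=> h; apply: (ls_sub ls); rewrite -coset_stab1.
  by rewrite coset_actE mulg1 => /coset_edgeE; rewrite invg1 mul1g => -[].
move=> hg; have [hgH|hgH] := pselect (H g).
  by left; move: hgH; rewrite -{1}coset_stab1.
by right; rewrite coset_actE mulg1; apply/coset_edgeE; rewrite invg1 mul1g.
Qed.

End CosetGraph.

Theorem hyperbolic_wdist (R : realType) H S : word_structure H S ->
  tdlc T -> compactly_generated T ->
  hyperbolic R T <-> hyperbolic_pmetric (wdist H S).
Proof.
move=> hS td cg; split.
  move=> [_ _ [V [e [act [ca he]]]]]; have [v0 v0P] := ca_transitive ca.
  apply: (hyperbolic_word_structure (ca_word_structure ca v0P) hS).
  exact/(hyperbolic_graph_wdist ca v0P R).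
move=> hd; split=> //; have ca := coset_graph hS.
exists (coset_vertex H), (@coset_edge H S), (coset_act hS); split=> //.
have v0P v : exists g, coset_act hS g (mkvertex hS 1%g) = v.
  by exists (val v); rewrite coset_actE mulg1 mkvertex_val.
by apply/(hyperbolic_graph_wdist ca v0P R); rewrite coset_stab1 coset_steps1.
Qed.

(** Enlarge a compact generating set to a symmetric one and multiply it by [H]
    on both sides. *)
Lemma word_structure_exists H : is_subgroup H -> open H -> compact H ->
  compactly_generated T -> exists S, word_structure H S.
Proof.
move=> hH oH cH [K [cK gK]].
pose K' := K `|` [set x | K (x^-1)%g] `|` [set 1%g].
pose HK := [set z | exists x y, [/\ H x, K' y & z = (x * y)%g]].
pose S := [set z | exists x y, [/\ HK x, H y & z = (x * y)%g]].
have KK : K `<=` K' by move=> x hx; left; left.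
have SP h k h' : H h -> K' k -> H h' -> S (h * k * h')%g.
  by move=> hh hk hh'; exists (h * k)%g, h'; split=> //; exists h, k.
have S_E x : S x -> exists h k h', [/\ H h, K' k, H h' & x = (h * k * h')%g].
  by move=> [_ [h' [[h [k [hh hk ->]]] hh' ->]]]; exists h, k, h'.
have h1 : H 1%g := subgroup1 hH.
have ls : length_system H S.
  split=> //.
  - by move=> h hh; rewrite -[h]mulg1 -[(h * 1)%g]mulg1; apply: SP => //; right.
  - move=> x /S_E[h [k [h' [hh hk hh' ->]]]]; rewrite !invgM mulgA.
    apply: SP; [exact: subgroupV| |exact: subgroupV].
    case: hk => [[hk|hk]| ->]; last by right; rewrite /= invg1.
      by left; right; rewrite /= invgK.
    by left; left.
  - move=> x h0 /S_E[h [k [h' [hh hk hh' ->]]]] hh0; rewrite -mulgA.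
    by apply: SP => //; apply: subgroupM.
exists S; split=> //.
  apply: compact_setM => //; apply: compact_setM => //.
  apply: compactU; last exact: compact_set1.
  by apply: compactU => //; apply: compact_setV.
move=> g; have : [set: T] g by [].
rewrite -gK => /(_ [set g | reached H S g]); apply; split.
  split; first exact: reachedH.
  by move=> x y hx hy; apply: (reachedM ls) => //; apply: (reachedV ls).
move=> x hx; exists 1%N; rewrite (wball1 ls) -[x]mulg1 -[x]mul1g.
by apply: SP => //; apply: KK.
Qed.

Lemma word_structure_generated H S : word_structure H S -> compactly_generated T.
Proof.
move=> hS; exists S; split; first exact: ws_compact hS.
apply/seteqP; split=> // g _ M [hM hSM].
have [n] := ws_reached hS g; elim: n g => [|n IH] g.
  by move=> hg; apply: hSM; apply: (ls_sub (ws_length hS)).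
move=> [x [s [/IH hx hs ->]]]; apply: subgroupM => //; exact: hSM.
Qed.

Lemma word_structure_locally_compact H S : word_structure H S ->
  locally_compact [set: T].
Proof.
move=> hS; have hH := ls_subgroup (ws_length hS).
move=> x _; rewrite withinET.
exists [set y | H (x^-1 * y)%g]; first exact: nbhs_lcoset (ws_open hS).
have cH := @compact_lcoset H x (compact_word_subgroup hS).
by split=> //; apply: compact_closed cH; exact: topgroup_hausdorff.
Qed.

End TopologicalGroups.

(** * The amalgam as a topological group *)

(** A connected set containing the identity lies in the clopen image of [A];
    there connectedness can be tested in [A]. *)
Lemma open_embedding_totally_disconnected (A G : topGroupType)
    (j : {multiplicative A -> G}) : open_embedding j ->
  totally_disconnected [set: A] -> totally_disconnected [set: G].
Proof.
move=> [j_inj cj oj] tdA x _; apply/seteqP; split=> [y|y ->]; last first.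
  exact: connected_component_refl.
move=> [K [Kx _ cK] Ky].
pose K1 : set G := (fun z => (x^-1 * z)%g) @` K.
have cK1 : connected K1.
  apply: connected_continuous_connected => //.
  by apply: continuous_subspaceT; apply: continuous_mull.
have K11 : K1 1%g by exists x => //; rewrite mulVg.
have oM : open (range j) by apply: oj; exact: openT.
have hM : is_subgroup (range j) by exact: range_subgroup.
have cM : closed (range j) by exact: open_subgroup_closed.
have j1 : range j 1%g by exact: subgroup1.
have KM : K1 `<=` range j.
  rewrite -(cK1 (K1 `&` range j)); first by move=> ? [].
  - by exists 1%g.
  - by exists (range j).
  - by exists (range j).
pose D := j @^-1` K1.
have imD (B O : set A) : B = D `&` O -> j @` B = K1 `&` j @` O.
  move=> ->; apply/seteqP; split=> z.
    by move=> [a [hD hO] <-]; split=> //; exists a.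
  by move=> [hz [a hO az]]; exists a => //; split=> //; rewrite /D /= az.
have cD : connected D.
  move=> B [b hb] [O oO BO] [F cF BF].
  have E : j @` B = K1.
    apply: cK1.
    - by exists (j b); exists b.
    - by exists (j @` O); [exact: oj|exact: imD].
    exists (j @` F); last exact: imD.
    have -> : j @` F = range j `&` ~` (j @` (~` F)).
      apply/seteqP; split=> z.
        move=> [a ha <-]; split; first by exists a.
        by move=> [a' ha' /j_inj e]; apply: ha'; rewrite e.
      move=> [[a _ <-] h]; exists a => //; apply: contrapT => nF.
      by apply: h; exists a.
    by apply: closedI => //; apply: open_closedC; apply: oj; apply: closed_openC.
  apply/seteqP; split=> a; first by rewrite BO => -[].
  by move=> ha; have [a' ha' /j_inj <-] : (j @` B) (j a) by rewrite E.
have Kxy : K1 (x^-1 * y)%g by exists y.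
have [a _ ay] := KM _ Kxy.
have : connected_component [set: A] 1%g a.
  exists D; last by rewrite /D /preimage /mkset ay.
  by split=> //; rewrite /D /preimage /mkset mulmorph1.
rewrite tdA // => a1; move: ay; rewrite a1 mulmorph1.
by move=> /(congr1 (fun z => x * z)%g); rewrite mulVKg mulg1.
Qed.

Lemma word_structure_tdlc (A G : topGroupType) (j : {multiplicative A -> G}) H S :
  open_embedding j -> tdlc A -> @word_structure G H S -> tdlc G.
Proof.
move=> hj [td _] hS; split; first exact: (open_embedding_totally_disconnected hj).
exact: word_structure_locally_compact hS.
Qed.

Theorem corollary3p2 (R : realType) (A B C G : topGroupType)
    (iA : {multiplicative C -> A}) (iB : {multiplicative C -> B})
    (jA : {multiplicative A -> G}) (jB : {multiplicative B -> G})
    (GAB : amalgamated_product iA iB jA jB)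
    (nontriv : nontrivial_amalgam iA iB)
    (tdlcA : tdlc A) (tdlcB : tdlc B)
    (cgA : compactly_generated A) (cgB : compactly_generated B)
    (compactC : compact [set: C]) :
  hyperbolic R G <-> hyperbolic R A /\ hyperbolic R B.
Proof.
have [[iA_inj ciA oiA] [iB_inj ciB oiB] glue univ ejA ejB] := GAB.
have [jA_inj cjA ojA] := ejA; have [jB_inj cjB ojB] := ejB.
have [SA wsA] : exists S, word_structure (range iA) S.
  apply: word_structure_exists => //; first exact: range_subgroup.
    by apply: oiA; exact: openT.
  exact: image_compact.
have [SB wsB] : exists S, word_structure (range iB) S.
  apply: word_structure_exists => //; first exact: range_subgroup.
    by apply: oiB; exact: openT.
  exact: image_compact.
have lsA := ws_length wsA; have lsB := ws_length wsB.
have rA := ws_reached wsA; have rB := ws_reached wsB.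
set H := amalgam_core iA jA; pose S := amalgam_steps jA jB SA SB.
set U := S false `|` S true.
have HM := amalgam_core_sub (jB := jB) glue.
have Msub := @amalgam_factor_subgroup A B G jA jB.
have lsS := amalgam_length_system glue lsA lsB.
have genM := amalgam_reached glue jA_inj jB_inj rA rB.
have red := amalgam_wlen_reduced glue univ iA_inj iB_inj jA_inj jB_inj lsA lsB rA rB.
have hasred := amalgam_has_reduced glue univ jA_inj jB_inj lsA lsB rA rB.
have wsG : word_structure H U.
  split; first exact: length_system_union.
  - by apply: ojA; apply: oiA; exact: openT.
  - by apply: compactU; apply: image_compact => //; [exact: ws_compact wsA|exact: ws_compact wsB].
  - exact: reached_all hasred.
have cgG := word_structure_generated wsG.
have tdG := word_structure_tdlc ejA tdlcA wsG.
rewrite (hyperbolic_wdist R wsG tdG cgG) (hyperbolic_wdist R wsA tdlcA cgA).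
rewrite (hyperbolic_wdist R wsB tdlcB cgB).
have dA x y : wdist H (S false) (jA x) (jA y) = wdist (range iA) SA x y.
  rewrite /wdist -mulmorphV -gmulfM; exact: wlen_amalgamA.
have dB x y : wdist H (S true) (jB x) (jB y) = wdist (range iB) SB x y.
  rewrite /wdist -mulmorphV -gmulfM; exact: wlen_amalgamB.
split=> [[delta h]|[[deltaA hA] [deltaB hB]]].
  have h4 b := @four_point_blocks _ _ _ _ Msub red _ h b.
  split; exists delta => x y z w.
    by rewrite -!dA; apply: (h4 false); eexists.
  by rewrite -!dB; apply: (h4 true); eexists.
exists (deltaA + deltaB); apply: (four_point_of_blocks HM Msub lsS genM red hasred).
case=> _ _ _ _ [x _ <-] [y _ <-] [z _ <-] [w _ <-].
  by rewrite !dB; apply: leq_trans (hB x y z w) _; rewrite leq_add2l leq_addl.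
by rewrite !dA; apply: leq_trans (hA x y z w) _; rewrite leq_add2l leq_addr.
Qed.
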